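(* Let $a,c,d$ be positive integers. There exists a homogeneous regular sequence $g_1,g_2,f_1,f_2$ in $\mathbb{C}[x_1,x_2,x_3,x_4]$ of type $S^{(2,2)}\oplus S^{(4)}\oplus S^{(4)}$ with degrees $(a,a,c,d)$ if and only if either (1) $a=2$ or $a=4$, and $(c,d)\neq(1,1)$; or (2) $a\ge 5$ and $(a-2,a-4,c,d)$ is a regular degree sequence for $n=4$.
   Context: Let $R=\mathbb{C}[x_1,x_2,x_3,x_4]$ with $\mathfrak{S}_4$ permuting the variables. A homogeneous regular sequence $g_1,g_2,f_1,f_2$ (i.e. homogeneous polynomials whose only common zero is the origin) is of type $S^{(2,2)}\oplus S^{(4)}\oplus S^{(4)}$ with degrees $(a,a,c,d)$ if $\deg g_1=\deg g_2=a$, the span of $g_1,g_2$ is $\mathfrak{S}_4$-stable and isomorphic to the irreducible 2-dimensional representation $S^{(2,2)}$ of $\mathfrak{S}_4$ (corresponding to the partition $(2,2)$), and $f_1,f_2$ are symmetric polynomials with $\deg f_1=c$, $\deg f_2=d$. An unordered sequence $(d_1,d_2,d_3,d_4)$ of positive integers is a regular degree sequence (for $n=4$) if there is a homogeneous regular sequence of four symmetric polynomials in $R$ of degrees $d_1,\dots,d_4$. *)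

(* Defs.v *)
From mathcomp Require Import all_boot all_algebra all_fingroup.
From mathcomp Require Import complex.
From mathcomp Require Import Rstruct.
From mathcomp Require Export mpoly.
From Stdlib Require Import Reals.
Import GRing.Theory.
Set Implicit Arguments. Unset Strict Implicit. Unset Printing Implicit Defensive.
Local Open Scope ring_scope.

Definition CC : closedFieldType := (Rdefinitions.R)[i].

(* R = C[x_1,x_2,x_3,x_4]; variables are indexed 0..3. *)
Notation poly4 := {mpoly CC[4]}.
Definition var (i : nat) : poly4 := 'X_(inord i).

Definition homog_of_deg (d : nat) (p : poly4) : Prop := p != 0 /\ p \is d.-homog.

(* Regular sequence of four homogeneous polynomials: only common zero is 0. *)
Definition common_zero_only_origin (p1 p2 p3 p4 : poly4) : Prop :=
  forall v : 'I_4 -> CC,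
    p1.@[v] = 0 -> p2.@[v] = 0 -> p3.@[v] = 0 -> p4.@[v] = 0 ->
    forall i, v i = 0.

(* The Specht module S^(2,2): spanned by the Specht polynomials of the
   standard tableaux of shape (2,2), (x1-x3)(x2-x4) and (x1-x2)(x3-x4). *)
Definition specht1 : poly4 := (var 0 - var 2) * (var 1 - var 3).
Definition specht2 : poly4 := (var 0 - var 1) * (var 2 - var 3).

(* span(g1,g2) is 2-dimensional, S_4-stable, and isomorphic to S^(2,2) as an
   S_4-representation: there is a basis h1,h2 of span(g1,g2) such that
   specht_i |-> h_i is S_4-equivariant. *)
Definition type_S22 (g1 g2 : poly4) : Prop :=
  (forall c1 c2 : CC, c1 *: g1 + c2 *: g2 = 0 -> c1 = 0 /\ c2 = 0) /\
  (forall (s : 'S_4) (c1 c2 : CC), exists e1 e2 : CC,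
      msym s (c1 *: g1 + c2 *: g2) = e1 *: g1 + e2 *: g2) /\
  exists h1 h2 : poly4,
    (exists a b c d : CC, h1 = a *: g1 + b *: g2 /\ h2 = c *: g1 + d *: g2
                          /\ a * d - b * c != 0) /\
    forall (s : 'S_4) (c1 c2 d1 d2 : CC),
      msym s (c1 *: specht1 + c2 *: specht2) = d1 *: specht1 + d2 *: specht2 ->
      msym s (c1 *: h1 + c2 *: h2) = d1 *: h1 + d2 *: h2.

(* Regular degree sequence for n = 4 (the property is invariant under
   reordering, so "unordered" needs no extra treatment). *)
Definition regular_degree_sequence (d1 d2 d3 d4 : nat) : Prop :=
  exists f1 f2 f3 f4 : poly4,
    [/\ f1 \is symmetric, f2 \is symmetric, f3 \is symmetric & f4 \is symmetric] /\
    [/\ homog_of_deg d1 f1, homog_of_deg d2 f2, homog_of_deg d3 f3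
      & homog_of_deg d4 f4] /\
    common_zero_only_origin f1 f2 f3 f4.

Definition regular_seq_type_S22_S4_S4 (a c d : nat) (g1 g2 f1 f2 : poly4) : Prop :=
  [/\ homog_of_deg a g1, homog_of_deg a g2, homog_of_deg c f1 & homog_of_deg d f2] /\
  type_S22 g1 g2 /\ f1 \is symmetric /\ f2 \is symmetric /\
  common_zero_only_origin g1 g2 f1 f2.

(* Main.v *)
Require Import Defs.
From mathcomp Require Import all_boot all_algebra all_fingroup.
From mathcomp Require Import all_order ring zify complex Rstruct mpoly.

(** The partition of four points into two pairs gives the resolvents
    [theta1 = x0 x1 + x2 x3], [theta2], [theta3], permuted by the symmetric
    group, and [S^(2,2)] is spanned by their differences.  Every copy of
    [S^(2,2)] in the polynomial ring is spanned by
    [(theta_i - theta_j) (A + B (theta_i + theta_j))] with [A], [B] symmetric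
    of degrees [a - 2] and [a - 4].  Hence the common zeros of [g1], [g2] are:
    the zeros of [A], [B]; the points [(s,s,u,v)] with
    [A + B (s + u) (s + v) = 0]; and the points with three equal coordinates.
    If [g1, g2, f1, f2] is regular then so is [A, B, f1, f2], up to replacing
    [A] or [B] by a power of the first elementary symmetric polynomial when it
    vanishes.  Conversely, a regular degree sequence [(a - 2, a - 4, c, d)]
    satisfies simple divisibility conditions, read off at
    [(1,w,w^2,0)], [(1,i,-1,-i)], the points [(s,-s,t,-t)] and the hyperplane
    [x0 + x1 + x2 + x3 = 0]; under these conditions [A, B, f1, f2] are given
    explicitly.  For [a] odd, [f1] and [f2] are chosen so that their common
    zeros of the form [(1,1,u,v)] have real nonnegative coordinates, where
    [A + B (1 + u) (1 + v)] is positive. *)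

Import GRing.Theory.
Set Implicit Arguments. Unset Strict Implicit. Unset Printing Implicit Defensive.
Local Open Scope ring_scope.

(** * Multivariate polynomials *)

(** For [a] even, one of [a - 2], [a - 4] is a multiple of 4, so divisibility by 3 is the only
    condition left, and [f2] can be a power of [E1]: every zero then lies in the hyperplane of
    coordinate sum zero, where few points up to scaling have two equal coordinates. For [a] odd this
    choice is impossible: [A] and [B] have odd degree, hence vanish at every [(s,-s,t,-t)], as [E1]
    does, and the remaining form has a zero among these points. This is why [c] and [d] must then be
    even, one of them a multiple of 4, and why the power of [E1] moves into [A] or [B]. The zeros of
    [f1], [f2] of the form [(1,1,u,v)] are no longer confined to a hyperplane, and
    [A + B (1 + u) (1 + v)] has to be nonzero at each of them, for exponents that grow with [a].
    Positivity settles all these points at once, provided that [f1] and [f2] have only real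
    nonnegative zeros there; the unusual coefficients of the odd case serve this purpose. *)

Lemma meval_msym (n : nat) (R : comNzRingType) (s : 'S_n) (p : {mpoly R[n]})
    (v : 'I_n -> R) :
  (msym s p).@[v] = p.@[fun i => v (s i)].
Proof.
rewrite {1}/msym /mmap raddf_sum mevalE; apply: eq_bigr => m _ /=.
rewrite mevalM mevalC; congr (_ * _).
by rewrite /mmap1 rmorph_prod; apply: eq_bigr => i _; rewrite rmorphXn /= mevalXU.
Qed.

Lemma meval_scale (n : nat) (R : comNzRingType) (d : nat) (p : {mpoly R[n]})
    (c : R) (v : 'I_n -> R) :
  p \is d.-homog -> p.@[fun i => c * v i] = c ^+ d * p.@[v].
Proof.
move=> /dhomogP hp; rewrite !mevalE mulr_sumr big_seq [RHS]big_seq.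
apply: eq_bigr => m /hp <-; rewrite mulrCA; congr (_ * _).
by rewrite /= mdegE -prodrXr -big_split; apply: eq_bigr => i _ /=; rewrite exprMn.
Qed.

Lemma meval0_dhomog (n : nat) (R : comNzRingType) (d : nat) (p : {mpoly R[n]}) :
  (0 < d)%N -> p \is d.-homog -> p.@[fun=> 0] = 0.
Proof.
move=> d0 hp; have := meval_scale 0 (fun=> 0) hp.
by rewrite expr0n; case: d d0 {hp} => // d _; rewrite !mul0r.
Qed.

(** The product [q * r] is its own component of degree [d], and [q] times the component of degree
    [k] of [r] has degree [e + k]. So only [k = d - e] contributes and [q] cancels; for [e > d]
    nothing contributes, whence [r = 0]. *)
Lemma dhomog_quot (n : nat) (R : idomainType) (d e : nat) (q r : {mpoly R[n]}) :
  q != 0 -> q \is e.-homog -> q * r \is d.-homog ->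
  (if (e <= d)%N then r \is (d - e).-homog else r == 0).
Proof.
move=> q0 hq hqr.
have key : q * r = q * (if (e <= d)%N then pihomog mdeg (d - e) r else 0).
  rewrite -{1}(pihomog_dE hqr) {1}(pihomog_partitionE (leqnn (mmeasure mdeg r))).
  rewrite mulr_sumr raddf_sum /=.
  have hk k : q * pihomog mdeg k r \is (e + k).-homog.
    exact: dhomogM hq (pihomogP _ _ _).
  case: leqP => [le_ed|lt_de]; last first.
    rewrite mulr0 big1 // => k _; apply: pihomog_ne0 (hk k).
    by rewrite gtn_eqF // ltn_addr.
  (* The decomposition of [r] stops at its measure; a component of degree [d - e] beyond this bound
     is zero. *)
  have [lt|ge] := ltnP (d - e) (mmeasure mdeg r).
    rewrite (bigD1 (Ordinal lt)) //= pihomog_dE; last first.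
      by have := hk (d - e)%N; rewrite subnKC.
    rewrite big1 ?addr0 // => k ne; apply: pihomog_ne0 (hk k).
    apply: contra ne => /eqP ed; apply/eqP/val_inj => /=.
    by rewrite -[X in (X - e)%N]ed addKn.
  rewrite big1 => [|k _]; last first.
    apply: pihomog_ne0 (hk k); apply/eqP => ed.
    by have := ltn_ord k; rewrite ltnNge (leq_trans ge) // -ed addKn.
  rewrite pihomogE big_seq_cond big1 ?mulr0 // => m /andP[hm /eqP dm].
  by move: ge; rewrite leqNgt -dm mmeasure_mnm_lt.
move/(mulfI q0): key; case: leqP => _ -> //.
exact: pihomogP.
Qed.

Lemma msym_symmetric_tperm (n : nat) (R : comNzRingType) (p : {mpoly R[n]}) :
  (forall i j, i != j -> msym (tperm i j) p = p) -> p \is symmetric.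
Proof.
move=> h; apply/issymP => s; have [ts -> /allP d] := prod_tpermP s.
elim: ts d => [|t ts IH] d; first by rewrite big_nil msym1m.
rewrite big_cons msymMm h; last by apply: d; rewrite mem_head.
by apply: IH => u us; apply: d; rewrite inE us orbT.
Qed.

(** With [t] the transposition, [x y - t x t y = x (y - t y) + (x - t x) t y], so divisibility
    passes to products and it suffices to check the variables. *)
Lemma tperm_sub_msym_factor (n : nat) (R : comNzRingType) (i j : 'I_n) (p : {mpoly R[n]}) :
  exists q, p - msym (tperm i j) p = ('X_i - 'X_j) * q.
Proof.
set t := msym _.
have hM x y : (exists q, x - t x = ('X_i - 'X_j) * q) ->
    (exists q, y - t y = ('X_i - 'X_j) * q) ->
    exists q, x * y - t (x * y) = ('X_i - 'X_j) * q.
  move=> [a ha] [b hb]; exists (x * b + a * t y).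
  have -> : t (x * y) = t x * t y by exact: msymM.
  have -> : x * y - t x * t y = x * (y - t y) + (x - t x) * t y by ring.
  by rewrite ha hb; ring.
have hX k : exists q, 'X_k - t 'X_k = ('X_i - 'X_j) * q :> {mpoly R[n]}.
  have -> : t 'X_k = 'X_(tperm i j k) :> {mpoly R[n]} by rewrite /t /msym mmapX mmap1U.
  case: tpermP => [->|->|_ _]; [exists 1|exists (-1)|exists 0]; ring.
have h1 : exists q, 1 - t 1 = ('X_i - 'X_j) * q :> {mpoly R[n]}.
  by exists 0; rewrite /t msym1 subrr mulr0.
elim/mpolyind: p => [|c m p _ _ [q hq]].
  by exists 0; rewrite /t msym0 subr0 mulr0.
suff [r hr] : exists r, 'X_[m] - t 'X_[m] = ('X_i - 'X_j) * r.
  exists (c *: r + q); rewrite /t msymD msymZ -/t opprD addrACA hq -scalerBr hr.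
  by rewrite mulrDr scalerAr.
rewrite mpolyXE_id; elim/big_ind: _ => [//|x y|k _]; first exact: hM.
by elim: (m k) => [|l IH]; rewrite ?expr0 // exprS; apply: hM.
Qed.

Lemma antisym_factor (n : nat) (R : fieldType) (i j : 'I_n) (p : {mpoly R[n]}) :
  2%:R != 0 :> R -> msym (tperm i j) p = - p -> exists q, p = ('X_i - 'X_j) * q.
Proof.
move=> two_neq0 hp; have [q hq] := tperm_sub_msym_factor i j p.
exists (2%:R^-1 *: q); rewrite -scalerAr -hq hp opprK -mulr2n -scaler_nat.
by rewrite scalerA mulVf ?scale1r.
Qed.

Lemma msymXU (n : nat) (R : comNzRingType) (s : 'S_n) (i : 'I_n) :
  msym s 'X_i = 'X_(s i) :> {mpoly R[n]}.
Proof. by rewrite /msym mmapX mmap1U. Qed.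

Lemma mpolyXU_sub_neq0 (n : nat) (R : comNzRingType) (i j : 'I_n) :
  i != j -> 'X_i - 'X_j != 0 :> {mpoly R[n]}.
Proof.
move=> ne; apply/eqP => /(congr1 (meval (fun k => (k == i)%:R))).
rewrite mevalB !mevalXU eqxx eq_sym (negbTE ne) subr0 meval0.
by move/eqP; rewrite oner_eq0.
Qed.

(** The second transposition fixes ['X_i - 'X_j], so the first cofactor is again antisymmetric. *)
Lemma antisym2_factor (n : nat) (R : fieldType) (i j k l : 'I_n) (p : {mpoly R[n]}) :
  2%:R != 0 :> R -> uniq [:: i; j; k; l] ->
  msym (tperm i j) p = - p -> msym (tperm k l) p = - p ->
  exists q, p = ('X_i - 'X_j) * ('X_k - 'X_l) * q.
Proof.
move=> two_neq0 /and4P[]; rewrite !inE !negb_or => /and3P[ij ik il] /andP[jk jl] kl _.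
move=> /(antisym_factor two_neq0) [q ->].
rewrite msymM msymB !msymXU !tpermD 1?eq_sym // -mulrN.
move/(mulfI (mpolyXU_sub_neq0 R ij)) => /(antisym_factor two_neq0) [r ->].
by exists r; rewrite mulrA.
Qed.

(** A degree bound with the coefficient at the bound, possibly zero: unlike [lead_coef], this is
    compatible with sums and products without any non-vanishing condition. *)
Definition top_coef (S : comNzRingType) (k : nat) (p : {poly S}) (t : S) : Prop :=
  (size p <= k.+1)%N /\ p`_k = t.

Lemma top_coefM (S : comNzRingType) (k l : nat) (p q : {poly S}) (t u : S) :
  top_coef k p t -> top_coef l q u -> top_coef (k + l) (p * q) (t * u).
Proof.
move=> [sp <-] [sq <-]; split.
  apply: leq_trans (size_polyMleq _ _) _.
  by have := leq_add sp sq; rewrite addnS addSn; case: (_ + _)%N.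
have lk : (k < (k + l).+1)%N by rewrite ltnS leq_addr.
rewrite coefM (bigD1 (Ordinal lk)) //= addKn big1 ?addr0 // => i /eqP ne.
have [lt|ge] := ltnP k i.
  by rewrite nth_default ?mul0r // (leq_trans sp).
rewrite [q`__]nth_default ?mulr0 // (leq_trans sq) //.
have lt : (i < k)%N.
  by rewrite ltn_neqAle ge andbT; apply/eqP => e; apply: ne; apply/val_inj.
by move: (nat_of_ord i) lt => j; lia.
Qed.

(** Only products of linear terms reach degree [d], so the coefficient there is [p] evaluated at the
    linear coefficients. The ring [S] is general because the elimination below takes it to be a
    polynomial ring in two variables. *)
Lemma top_coef_mmap (n : nat) (K S : comNzRingType) (f : {rmorphism K -> S})
    (h : 'I_n -> {poly S}) (d : nat) (p : {mpoly K[n]}) :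
  (forall i, (size (h i) <= 2)%N) -> p \is d.-homog ->
  top_coef d (mmap (polyC \o f) h p) (mmap f (fun i => (h i)`_1) p).
Proof.
move=> hh /dhomogP hp; rewrite /mmap.
rewrite [X in top_coef d X]big_seq [X in top_coef d _ X]big_seq.
apply: (big_ind2 (fun x y => top_coef d x y)).
- by split; rewrite ?size_poly0 ?coef0.
- move=> x t y u [sx <-] [sy <-]; split; rewrite ?coefD //.
  by rewrite (leq_trans (size_polyD _ _)) // geq_max sx sy.
move=> m /hp /= dm; rewrite -[d]add0n; apply: top_coefM.
  by split; rewrite ?coefC // size_polyC; case: (_ == _).
rewrite -dm mdegE /mmap1.
elim/big_rec3: _ => [|i x k y _ IH]; first by split; rewrite ?size_poly1 ?coef1.
apply: top_coefM => //; elim: (m i) => [|l IHl].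
  by split; rewrite ?expr0 ?size_poly1 ?coef1.
by rewrite !exprS -add1n; apply: top_coefM.
Qed.

(** * Common zeros of homogeneous polynomials *)

Lemma rmorph_mmap (n : nat) (K S T : comNzRingType) (g : {rmorphism S -> T}) (f : K -> S)
    (f' : K -> T) (h : 'I_n -> S) (h' : 'I_n -> T) (p : {mpoly K[n]}) :
  (forall c, g (f c) = f' c) -> (forall i, g (h i) = h' i) ->
  g (mmap f h p) = mmap f' h' p.
Proof.
move=> hf hh; rewrite /mmap rmorph_sum; apply: eq_bigr => m _.
rewrite rmorphM hf; congr (_ * _); rewrite /mmap1 rmorph_prod.
by apply: eq_bigr => i _; rewrite rmorphXn hh.
Qed.

(** If [p] does not vanish at [P], its value at [x P + Q] is a polynomial in [x] with leading
    coefficient [p.@[P]] and degree [d > 0], hence has a root. *)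
Lemma homog_zero_on_line (K : closedFieldType) (n d : nat) (p : {mpoly K[n]})
    (P Q : 'I_n -> K) :
  (0 < d)%N -> p \is d.-homog ->
  exists s t, (s != 0) || (t != 0) /\ p.@[fun i => s * P i + t * Q i] = 0.
Proof.
move=> d0 hp; have [pP|pP] := eqVneq p.@[P] 0.
  exists 1, 0; rewrite oner_eq0; split=> //.
  by rewrite -[RHS]pP; apply: meval_eq => i; rewrite mul1r mul0r addr0.
pose h i : {poly K} := P i *: 'X + (Q i)%:P.
have sh i : (size (h i) <= 2)%N.
  rewrite (leq_trans (size_polyD _ _)) // geq_max (leq_trans (size_scale_leq _ _)) ?size_polyX //.
  by rewrite (leq_trans (size_polyC_leq1 _)).
have [sr tr] := top_coef_mmap idfun sh hp.
set r := mmap _ _ _ in sr tr.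
have r_d : r`_d != 0.
  rewrite tr; suff -> : mmap idfun (fun i => (h i)`_1) p = p.@[P] by [].
  by apply: meval_eq => i; rewrite coefD coefZ coefX coefC mulr1 addr0.
have sz : size r != 1.
  apply: contra r_d => /eqP s1; rewrite nth_default // s1.
  by case: d d0 {hp sr tr}.
have [x /rootP rx] := closed_rootP _ sz.
exists x, 1; rewrite oner_eq0 orbT; split=> //.
rewrite -[RHS]rx -[r.[x]]/(horner_eval x r); apply/esym.
apply: rmorph_mmap => [c|i]; rewrite /= /horner_eval ?hornerC //.
by rewrite /h !hornerE mulrC.
Qed.

Section Net.

Variables (K : closedFieldType) (n N : nat) (p q : {mpoly K[n]}) (P Q T : 'I_n -> K).
Hypotheses (N0 : (0 < N)%N) (hp : p \is N.-homog) (hq : q \is N.-homog).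
Hypotheses (pT : p.@[T] != 0) (qT : q.@[T] != 0).

(** Elimination by a resultant. A point of the net is [x P + y Q + z T], with [x] the inner, [y] the
    middle and [z] the outer variable. *)
Let f : {rmorphism K -> {poly {poly K}}} := polyC \o polyC.
Let h (i : 'I_n) : {poly {poly {poly K}}} :=
  f (T i) *: 'X + ('X%:P * f (P i) + 'X * f (Q i))%:P.
Let ev (x y : K) : {rmorphism {poly {poly K}} -> K} := horner_eval x \o horner_eval y%:P.
Let net (r : {mpoly K[n]}) := mmap (polyC \o f) h r.

Let ev_f x y c : ev x y (f c) = c.
Proof. by rewrite /= /horner_eval !hornerC. Qed.

(** The leading coefficient in [z] is the nonzero constant [r.@[T]], so no specialisation of [x],
    [y] lowers the degree, and the resultant commutes with [ev x y]. *)
Let net_lead r : r \is N.-homog -> r.@[T] != 0 ->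
  net r != 0 /\ (forall x y, ev x y (lead_coef (net r)) != 0).
Proof.
move=> hr rT.
have sh i : (size (h i) <= 2)%N.
  rewrite (leq_trans (size_polyD _ _)) // geq_max (leq_trans (size_scale_leq _ _)) ?size_polyX //.
  by rewrite (leq_trans (size_polyC_leq1 _)).
have [sr] := top_coef_mmap f sh hr; rewrite -/(net r).
have <- : f r.@[T] = mmap f (fun i => (h i)`_1) r.
  apply: rmorph_mmap => // i.
  by rewrite coefD coefZ coefX coefC mulr1 addr0.
move=> tr.
have nz : (net r)`_N != 0 by rewrite tr /= !polyC_eq0.
have sz : size (net r) = N.+1.
  apply/eqP; rewrite eqn_leq sr ltnNge; apply: contra nz => le.
  by rewrite nth_default.
split; first by rewrite -size_poly_eq0 sz.
by move=> x y; rewrite lead_coefE sz tr ev_f.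
Qed.

Let net_eval r x y z :
  (map_poly (ev x y) (net r)).[z] = r.@[fun i => x * P i + y * Q i + z * T i].
Proof.
rewrite -[LHS]/((horner_eval z \o map_poly (ev x y)) (net r)).
apply: rmorph_mmap => [c|i].
  by rewrite /= map_polyC /= /horner_eval !hornerC.
rewrite /h /= rmorphD /= map_polyZ map_polyX map_polyC /= /horner_eval !hornerE /=.
by ring.
Qed.

Let resultant_ev x y : ev x y (resultant (net p) (net q)) =
  resultant (map_poly (ev x y) (net p)) (map_poly (ev x y) (net q)).
Proof. by apply: map_resultant; apply: (net_lead _ _).2. Qed.

Let zero_of_resultant x y : ev x y (resultant (net p) (net q)) = 0 ->
  exists z, p.@[fun i => x * P i + y * Q i + z * T i] = 0 /\
            q.@[fun i => x * P i + y * Q i + z * T i] = 0.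
Proof.
rewrite resultant_ev => /eqP; rewrite resultant_eq0 => sg.
have /closed_rootP [z] : size (gcdp (map_poly (ev x y) (net p)) (map_poly (ev x y) (net q))) != 1.
  by rewrite gtn_eqF.
by rewrite root_gcd => /andP[/rootP zp /rootP zq]; exists z; rewrite -!net_eval.
Qed.

Let resultant_ev00 : ev 0 0 (resultant (net p) (net q)) = 0.
Proof.
rewrite resultant_ev; apply/eqP; rewrite resultant_eq0 ltnNge; apply/negP => le1.
have g0 : gcdp (map_poly (ev 0 0) (net p)) (map_poly (ev 0 0) (net q)) != 0.
  rewrite gcdp_eq0 negb_and; apply/orP; left.
  by rewrite map_poly_eq0_id0 ?(net_lead hp pT).1 ?(net_lead hp pT).2.
have : root (gcdp (map_poly (ev 0 0) (net p)) (map_poly (ev 0 0) (net q))) 0.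
  rewrite root_gcd /root !net_eval.
  have e r : r.@[fun i => 0 * P i + 0 * Q i + 0 * T i] = r.@[fun=> 0].
    by apply: meval_eq => i; rewrite !mul0r !addr0.
  by rewrite !e (meval0_dhomog N0 hp) (meval0_dhomog N0 hq) eqxx.
by move/(root_size_gt1 g0); rewrite ltnNge le1.
Qed.

(* The resultant in [z] is a polynomial in [x], [y] vanishing at the origin,
   hence it has another zero. *)
Lemma monic_homog_pair_zero_in_net : exists x y z,
  [|| x != 0, y != 0 | z != 0] /\
  p.@[fun i => x * P i + y * Q i + z * T i] = 0 /\
  q.@[fun i => x * P i + y * Q i + z * T i] = 0.
Proof.
suff [x [y [xy r0]]] : exists x y, (x != 0) || (y != 0) /\
    ev x y (resultant (net p) (net q)) = 0.
  have [z hz] := zero_of_resultant r0; exists x, y, z; split=> //.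
  by case/orP: xy => ->; rewrite ?orbT.
have r00 := resultant_ev00; set r := resultant _ _ in r00 *.
(* [D] is the difference of [r] at [x = 1] and at [x = 0], as a polynomial in [y]. If [D = 0], then
   [r] vanishes at [(1, 0)] as it does at the origin. Otherwise some [y != 0] has [D.[y] != 0]; for
   this [y], [r] is not constant in [x], hence has a root. *)
pose D := map_poly (horner_eval 1) r - map_poly (horner_eval 0) r.
have evD y : D.[y] = r.[y%:P].[1] - r.[y%:P].[0].
  have e a : (map_poly (horner_eval a) r).[y] = r.[y%:P].[a].
    by rewrite -[X in _.[X] = _](hornerC y a); exact: (horner_map (horner_eval a) r y%:P).
  by rewrite /D hornerD hornerN !e.
have [D0|Dn0] := eqVneq D 0.
  exists 1, 0; rewrite oner_eq0; split=> //.
  have := evD 0; rewrite D0 horner0 => /esym/eqP; rewrite subr_eq0 => /eqP.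
  by move: r00; rewrite /ev /= /horner_eval => -> ->.
have DX0 : D * 'X != 0 by rewrite mulf_neq0 ?polyX_eq0.
have [y] := closed_nonrootP _ DX0.
rewrite /root hornerM hornerX mulf_eq0 negb_or evD subr_eq0 => /andP[ne y0].
have /closed_rootP [x /rootP rx] : size r.[y%:P] != 1.
  by apply: contra ne => /size_poly1P [c _ ->]; rewrite !hornerC.
by exists x, y; rewrite y0 orbT.
Qed.

End Net.

(** Powers equalise the degrees. If [T] is not itself a common zero, one form is nonzero at [T];
    adding its power to that of the other, when needed, makes both nonzero at [T] and keeps the
    common zeros. *)
Lemma homog_pair_zero_in_net (K : closedFieldType) (n d e : nat) (p q : {mpoly K[n]})
    (P Q T : 'I_n -> K) :
  (0 < d)%N -> (0 < e)%N -> p \is d.-homog -> q \is e.-homog ->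
  exists x y z, [|| x != 0, y != 0 | z != 0] /\
    p.@[fun i => x * P i + y * Q i + z * T i] = 0 /\
    q.@[fun i => x * P i + y * Q i + z * T i] = 0.
Proof.
wlog pT : p q d e / p.@[T] != 0.
  move=> wl d0 e0 hp hq; have [pT|pT] := eqVneq p.@[T] 0; last exact: wl hp hq.
  have [qT|qT] := eqVneq q.@[T] 0; last first.
    by have [x [y [z [h [h1 h2]]]]] := wl q p e d qT e0 d0 hq hp; exists x, y, z.
  exists 0, 0, 1; rewrite oner_eq0 !orbT; split=> //.
  by split; [rewrite -[RHS]pT|rewrite -[RHS]qT]; apply: meval_eq => i; rewrite !mul0r !add0r mul1r.
move=> d0 e0 hp hq.
have hp' : p ^+ e \is (d * e).-homog by apply: dhomogMn.
have hq' : q ^+ d \is (d * e).-homog by rewrite mulnC; apply: dhomogMn.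
have pT' : (p ^+ e).@[T] != 0 by rewrite rmorphXn expf_neq0.
pose q' := if q.@[T] == 0 then q ^+ d + p ^+ e else q ^+ d.
have hq'' : q' \is (d * e).-homog by rewrite /q'; case: ifP => _ //; apply: rpredD.
have qT' : q'.@[T] != 0.
  rewrite /q'; case: ifP => [/eqP qT|/negbT qT]; last by rewrite rmorphXn expf_neq0.
  by rewrite mevalD rmorphXn /= qT expr0n gtn_eqF // add0r.
have [|x [y [z [h [h1 h2]]]]] := monic_homog_pair_zero_in_net P Q _ hp' hq'' pT' qT'.
  by rewrite muln_gt0 d0.
exists x, y, z; split=> //.
have p0 : p.@[fun i => x * P i + y * Q i + z * T i] = 0.
  by move/eqP: h1; rewrite rmorphXn /= expf_eq0 e0 => /eqP.
split=> //; move: h2; rewrite /q'; case: ifP => _.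
  rewrite mevalD h1 addr0 => /eqP; by rewrite rmorphXn /= expf_eq0 d0 => /eqP.
by move/eqP; rewrite rmorphXn /= expf_eq0 d0 => /eqP.
Qed.

(** * Copies of [S^(2,2)] and the resolvents *)

(** The carrier of [CC] with its order: the source of characteristic zero here and of positivity in
    the odd case. *)
Definition CCnum : numClosedFieldType := (Rdefinitions.R)[i].

Lemma natr_CC_neq0 (k : nat) : (k.+1)%:R != 0 :> CC.
Proof. by apply: negbT; exact (Num.Theory.pnatr_eq0 CCnum k.+1). Qed.

Definition pt (x y z w : CC) (i : 'I_4) : CC := nth 0 [:: x; y; z; w] i.

Lemma eval_var (k : nat) (x y z w : CC) : (k < 4)%N ->
  (var k).@[pt x y z w] = nth 0 [:: x; y; z; w] k.
Proof. by move=> k4; rewrite mevalXU /pt inordK. Qed.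

Lemma eval_pt (p : poly4) (v : 'I_4 -> CC) :
  p.@[v] = p.@[pt (v (inord 0)) (v (inord 1)) (v (inord 2)) (v (inord 3))].
Proof.
apply: meval_eq => -[[|[|[|[|//]]]] lt]; rewrite /pt /=; congr v;
  by apply/val_inj; rewrite /= inordK.
Qed.

Lemma tperm_inord (n a b k : nat) : (a <= n)%N -> (b <= n)%N -> (k <= n)%N ->
  tperm (inord a) (inord b) (inord k) =
  inord (if k == a then b else if k == b then a else k) :> 'I_n.+1.
Proof.
move=> an bn kn; have e c : (c <= n)%N -> (inord k == inord c :> 'I_n.+1) = (k == c).
  by move=> cn; rewrite -val_eqE /= !inordK.
case: tpermP => [/eqP|/eqP|/eqP na /eqP nb].
- by rewrite e // => ->.
- by rewrite e // => /eqP ->; rewrite eqxx; case: (b =P a) => [->|].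
- by move: na nb; rewrite !e // => /negbTE -> /negbTE ->.
Qed.

Lemma tperm_var (a b k : nat) : (a < 4)%N -> (b < 4)%N -> (k < 4)%N ->
  msym (tperm (inord a) (inord b)) (var k) =
  var (if k == a then b else if k == b then a else k).
Proof. by move=> a4 b4 k4; rewrite /var msymXU tperm_inord. Qed.

Lemma symmetric4 (p : poly4) :
  (forall a b, (a < b < 4)%N -> msym (tperm (inord a) (inord b)) p = p) ->
  p \is symmetric.
Proof.
move=> h; apply: msym_symmetric_tperm => i j.
wlog lt : i j / (i < j)%N.
  move=> wl ij; have [lt|gt|/val_inj e] := ltngtP i j; first exact: wl.
  - by rewrite tpermC; apply: wl; rewrite // eq_sym.
  - by rewrite e eqxx in ij.
by move=> _; rewrite -(inord_val i) -(inord_val j); apply: h; rewrite lt /=.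
Qed.

Lemma eval_tperm (p : poly4) (a b : nat) (v : 'I_4 -> CC) : p \is symmetric ->
  p.@[fun i => v (tperm (inord a) (inord b) i)] = p.@[v].
Proof. by move=> /issymP sp; rewrite -meval_msym sp. Qed.

Lemma sym_swap01 (p : poly4) (x y z w : CC) : p \is symmetric ->
  p.@[pt x y z w] = p.@[pt y x z w].
Proof.
move=> sp; rewrite -[RHS](eval_tperm 0 1 _ sp) [RHS]eval_pt.
by rewrite !tperm_inord //= /pt !inordK.
Qed.

Lemma sym_swap12 (p : poly4) (x y z w : CC) : p \is symmetric ->
  p.@[pt x y z w] = p.@[pt x z y w].
Proof.
move=> sp; rewrite -[RHS](eval_tperm 1 2 _ sp) [RHS]eval_pt.
by rewrite !tperm_inord //= /pt !inordK.
Qed.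

Lemma sym_swap23 (p : poly4) (x y z w : CC) : p \is symmetric ->
  p.@[pt x y z w] = p.@[pt x y w z].
Proof.
move=> sp; rewrite -[RHS](eval_tperm 2 3 _ sp) [RHS]eval_pt.
by rewrite !tperm_inord //= /pt !inordK.
Qed.

Ltac var_ring := move: (var 0) (var 1) (var 2) (var 3) => x0 x1 x2 x3; ring.

Definition theta1 : poly4 := var 0 * var 1 + var 2 * var 3.
Definition theta2 : poly4 := var 0 * var 2 + var 1 * var 3.
Definition theta3 : poly4 := var 0 * var 3 + var 1 * var 2.

Lemma specht1E : specht1 = theta1 - theta3.
Proof. by rewrite /specht1 /theta1 /theta3; var_ring. Qed.

Lemma specht2E : specht2 = theta2 - theta3.
Proof. by rewrite /specht2 /theta2 /theta3; var_ring. Qed.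

Lemma var_sub_neq0 (a b : nat) : (a < 4)%N -> (b < 4)%N -> a != b -> var a - var b != 0.
Proof. by move=> a4 b4 ab; apply: mpolyXU_sub_neq0; rewrite -val_eqE /= !inordK. Qed.

Lemma var_sub_mul_factor (a b c d : nat) (p : poly4) :
  all (fun k => k < 4)%N [:: a; b; c; d] -> uniq [:: a; b; c; d] ->
  msym (tperm (inord a) (inord b)) p = - p -> msym (tperm (inord c) (inord d)) p = - p ->
  exists q, p = (var a - var b) * (var c - var d) * q.
Proof.
move=> /and5P[a4 b4 c4 d4 _] u; apply: antisym2_factor; first exact: natr_CC_neq0.
by move: u; rewrite /= !inE -!val_eqE /= !inordK.
Qed.

(** If [h1 = s1 (A + B (t1 + t3))] and [h2 = s2 (A + B (t2 + t3))], then, as [s3 = t1 - t2], solving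
    for [B] and [A] gives the last two expressions divided by [s1 s2 s3]. All three alternate, so
    the quotients are symmetric. The ring and the action are abstract, so that each of the six
    transpositions is a [ring] identity. *)
Lemma resolvent_alternating (R : comNzRingType) (x : nat -> R) (h1 h2 : R)
    (m : nat -> nat -> R -> R) :
  (forall a b, {morph m a b : y z / y - z}) -> (forall a b, {morph m a b : y z / y + z}) ->
  (forall a b, {morph m a b : y z / y * z}) ->
  (forall a b k, (a < 4)%N -> (b < 4)%N -> (k < 4)%N ->
     m a b (x k) = x (if k == a then b else if k == b then a else k)) ->
  m 0 2 h1 = - h1 /\ m 1 3 h1 = - h1 ->
  m 0 1 h2 = - h2 /\ m 2 3 h2 = - h2 ->
  m 0 3 h1 = h2 /\ m 1 2 h1 = h2 ->
  m 0 3 h2 = h1 /\ m 1 2 h2 = h1 ->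
  m 0 1 h1 = h1 - h2 /\ m 2 3 h1 = h1 - h2 ->
  m 0 2 h2 = h2 - h1 /\ m 1 3 h2 = h2 - h1 ->
  let t1 := x 0 * x 1 + x 2 * x 3 in
  let t2 := x 0 * x 2 + x 1 * x 3 in
  let t3 := x 0 * x 3 + x 1 * x 2 in
  let s1 := (x 0 - x 2) * (x 1 - x 3) in
  let s2 := (x 0 - x 1) * (x 2 - x 3) in
  let s3 := (x 0 - x 3) * (x 1 - x 2) in
  forall a b, (a < b < 4)%N ->
  [/\ m a b (s1 * s2 * s3) = - (s1 * s2 * s3),
      m a b (h1 * s2 - h2 * s1) = - (h1 * s2 - h2 * s1) &
      m a b (h2 * s1 * (t1 + t3) - h1 * s2 * (t2 + t3)) =
        - (h2 * s1 * (t1 + t3) - h1 * s2 * (t2 + t3))].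
Proof.
move=> mB mD mM mx h1N h2N h12 h21 h1D h2D /= a b /andP[ab b4].
case: b b4 ab => [|[|[|[|b]]]] // _; case: a => [|[|[|a]]] //= _;
  rewrite !(mB, mM, mD) !mx //=
    ?h1N.1 ?h1N.2 ?h2N.1 ?h2N.2 ?h12.1 ?h12.2 ?h21.1 ?h21.2 ?h1D.1 ?h1D.2 ?h2D.1 ?h2D.2;
  split; ring.
Qed.

(* [h1] is divisible by [specht1] and [h2] by [specht2] because of their signs
   under transpositions; the difference of the quotients changes sign under the
   transpositions exchanging [theta1] and [theta2], which gives [B]. *)
Lemma S22_resolvent_form (h1 h2 : poly4) :
  (forall (s : 'S_4) (c1 c2 d1 d2 : CC),
      msym s (c1 *: specht1 + c2 *: specht2) = d1 *: specht1 + d2 *: specht2 ->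
      msym s (c1 *: h1 + c2 *: h2) = d1 *: h1 + d2 *: h2) ->
  exists A B, [/\ A \is symmetric, B \is symmetric,
    h1 = specht1 * (A + B * (theta1 + theta3)) &
    h2 = specht2 * (A + B * (theta2 + theta3))].
Proof.
move=> E.
have E1 s d1 d2 : msym s specht1 = d1 *: specht1 + d2 *: specht2 ->
    msym s h1 = d1 *: h1 + d2 *: h2.
  by have := E s 1 0 d1 d2; rewrite !scale1r !scale0r !addr0.
have E2 s d1 d2 : msym s specht2 = d1 *: specht1 + d2 *: specht2 ->
    msym s h2 = d1 *: h1 + d2 *: h2.
  by have := E s 0 1 d1 d2; rewrite !scale1r !scale0r !add0r.
pose t a b : 'S_4 := tperm (inord a) (inord b).
have tvar a b k : (a < 4)%N -> (b < 4)%N -> (k < 4)%N ->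
   msym (t a b) (var k) = var (if k == a then b else if k == b then a else k).
  exact: tperm_var.
have s1 a b : (a < b < 4)%N -> msym (t a b) specht1 =
    (var (if 0 == a then b else if 0 == b then a else 0)%N -
     var (if 2 == a then b else if 2 == b then a else 2)%N) *
    (var (if 1 == a then b else if 1 == b then a else 1)%N -
     var (if 3 == a then b else if 3 == b then a else 3)%N).
  by move=> ab; rewrite /specht1 msymM !msymB !tvar //; lia.
have s2 a b : (a < b < 4)%N -> msym (t a b) specht2 =
    (var (if 0 == a then b else if 0 == b then a else 0)%N -
     var (if 1 == a then b else if 1 == b then a else 1)%N) *
    (var (if 2 == a then b else if 2 == b then a else 2)%N -
     var (if 3 == a then b else if 3 == b then a else 3)%N).
  by move=> ab; rewrite /specht2 msymM !msymB !tvar //; lia.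
have h1N : msym (t 0 2) h1 = - h1 /\ msym (t 1 3) h1 = - h1.
  by split; rewrite (E1 _ (-1) 0) ?s1 //= ?scaleN1r ?scale0r ?addr0 // /specht1; var_ring.
have h2N : msym (t 0 1) h2 = - h2 /\ msym (t 2 3) h2 = - h2.
  by split; rewrite (E2 _ 0 (-1)) ?s2 //= ?scaleN1r ?scale0r ?add0r // /specht2; var_ring.
have h12 : msym (t 0 3) h1 = h2 /\ msym (t 1 2) h1 = h2.
  by split; rewrite (E1 _ 0 1) ?s1 //= ?scale1r ?scale0r ?add0r // /specht2; var_ring.
have h21 : msym (t 0 3) h2 = h1 /\ msym (t 1 2) h2 = h1.
  by split; rewrite (E2 _ 1 0) ?s2 //= ?scale1r ?scale0r ?addr0 // /specht1; var_ring.
have h1D : msym (t 0 1) h1 = h1 - h2 /\ msym (t 2 3) h1 = h1 - h2.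
  by split; rewrite (E1 _ 1 (-1)) ?s1 //= ?scaleN1r ?scale1r // /specht1 /specht2; var_ring.
have h2D : msym (t 0 2) h2 = h2 - h1 /\ msym (t 1 3) h2 = h2 - h1.
  by split; rewrite (E2 _ (-1) 1) ?s2 //= ?scaleN1r ?scale1r // 1?[- h1 + h2]addrC //
    /specht1 /specht2; var_ring.
have sp1_neq0 : specht1 != 0 by rewrite mulf_neq0 ?var_sub_neq0.
have sp2_neq0 : specht2 != 0 by rewrite mulf_neq0 ?var_sub_neq0.
pose specht3 := (var 0 - var 3) * (var 1 - var 2).
have sp3_neq0 : specht3 != 0 by rewrite mulf_neq0 ?var_sub_neq0.
clear E E1 E2.
have [u1 hu1] : exists u, h1 = specht1 * u by case: h1N; apply: var_sub_mul_factor.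
have [u2 hu2] : exists u, h2 = specht2 * u by case: h2N; apply: var_sub_mul_factor.
have uswap s : msym s h1 = h2 -> msym s h2 = h1 ->
    msym s specht1 = specht2 -> msym s specht2 = specht1 ->
    msym s (u1 - u2) = - (u1 - u2).
  move=> e1 e2 f1 f2; rewrite msymB opprB; congr (_ - _).
    by apply: (mulfI sp2_neq0); rewrite -hu2 -e1 hu1 msymM f1.
  by apply: (mulfI sp1_neq0); rewrite -hu1 -e2 hu2 msymM f2.
have [B hB] : exists B, u1 - u2 = specht3 * B.
  apply: var_sub_mul_factor => //; apply: uswap; rewrite ?h12.1 ?h12.2 ?h21.1 ?h21.2 // ?s1 ?s2 //=;
    rewrite /specht1 /specht2; var_ring.
pose A := u1 - B * (theta1 + theta3).
have D_neq0 : specht1 * specht2 * specht3 != 0.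
  exact: mulf_neq0 (mulf_neq0 sp1_neq0 sp2_neq0) sp3_neq0.
have BD : B * (specht1 * specht2 * specht3) = h1 * specht2 - h2 * specht1.
  have -> : B * (specht1 * specht2 * specht3) = specht1 * specht2 * (specht3 * B) by var_ring.
  by rewrite -hB hu1 hu2; var_ring.
have AD : A * (specht1 * specht2 * specht3) =
    h2 * specht1 * (theta1 + theta3) - h1 * specht2 * (theta2 + theta3).
  have -> : A * (specht1 * specht2 * specht3) =
      u1 * specht1 * specht2 * specht3 - B * (specht1 * specht2 * specht3) * (theta1 + theta3).
    by rewrite /A; var_ring.
  rewrite BD hu1 hu2 /theta1 /theta2 /theta3 /specht1 /specht2 /specht3; var_ring.
have alt : forall a b, (a < b < 4)%N -> _ :=
  resolvent_alternating (fun a b => msymB (t a b)) (fun a b => msymD (t a b))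
    (fun a b => msymM (t a b)) tvar h1N h2N h12 h21 h1D h2D.
have sym_of X : (forall a b, (a < b < 4)%N ->
     msym (t a b) (X * (specht1 * specht2 * specht3)) = - (X * (specht1 * specht2 * specht3))) ->
    X \is symmetric.
  move=> hX; apply: symmetric4 => a b ab; apply/(mulIf D_neq0)/oppr_inj.
  by rewrite -(hX a b ab) msymM; have [-> _ _] := alt a b ab; rewrite mulrN.
exists A, B; split.
- by apply: sym_of => a b ab; rewrite AD; have [_ _] := alt a b ab.
- by apply: sym_of => a b ab; rewrite BD; have [] := alt a b ab.
- by rewrite hu1 /A; congr (_ * _); var_ring.
- rewrite hu2; congr (_ * _); have -> : u2 = u1 - specht3 * B by rewrite -hB; var_ring.
  by rewrite /A /theta1 /theta2 /theta3 /specht3; var_ring.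
Qed.

(** * The action on the resolvents and the copies built from them *)

Definition theta (i : 'I_3) : poly4 := nth 0 [:: theta1; theta2; theta3] i.

(** The surjection of the symmetric group on four letters onto that on three: a transposition fixes
    the resolvent that pairs its two indices and exchanges the other two. *)
Lemma theta_tperm (R : comNzRingType) (x : nat -> R) (m : R -> R) (a b : nat) :
  (a < b < 4)%N -> {morph m : y z / y + z} -> {morph m : y z / y * z} ->
  (forall k, (k < 4)%N -> m (x k) = x (if k == a then b else if k == b then a else k)) ->
  let th := [:: x 0 * x 1 + x 2 * x 3; x 0 * x 2 + x 1 * x 3; x 0 * x 3 + x 1 * x 2] in
  exists p q, [/\ (p <= 2)%N, (q <= 2)%N & forall k, (k <= 2)%N ->
    m th`_k = th`_(if k == p then q else if k == q then p else k)].
Proof.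
move=> /andP[ab b4] mD mM mx.
exists (if ((a, b) == (0, 1)) || ((a, b) == (2, 3)) then 1 else 0)%N.
exists (if ((a, b) == (0, 3)) || ((a, b) == (1, 2)) then 1 else 2)%N.
split; [by case: ifP|by case: ifP|].
case: b b4 ab mx => [|[|[|[|b]]]] // _; case: a => [|[|[|a]]] // _ mx;
  move=> [|[|[|k]]] // _; rewrite /= mD !mM !mx //=; ring.
Qed.

Lemma theta_inord (k : nat) : (k <= 2)%N ->
  theta (inord k) = [:: theta1; theta2; theta3]`_k.
Proof. by move=> k2; rewrite /theta inordK. Qed.

Lemma msym_theta (s : 'S_4) : exists u : 'S_3, forall i, msym s (theta i) = theta (u i).
Proof.
have [ts -> /allP d] := prod_tpermP s.
elim: ts d => [|[i j] ts IH] d.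
  by exists 1%g => i; rewrite big_nil msym1m perm1.
have [u hu] : exists u : 'S_3, forall i, msym (\prod_(t <- ts) tperm t.1 t.2) (theta i) = theta (u i).
  by apply: IH => t tts; apply: d; rewrite inE tts orbT.
suff [w hw] : exists w : 'S_3, forall k, msym (tperm i j) (theta k) = theta (w k).
  by exists (w * u)%g => k; rewrite big_cons msymMm hw hu permM.
have : i != j by apply: (d (i, j)); rewrite mem_head.
wlog lt : i j d / (i < j)%N.
  move=> wl ij; have [lt|gt|/val_inj e] := ltngtP i j; first exact: wl.
  - rewrite tpermC; apply: wl; rewrite 1?eq_sym // => t; rewrite inE => /orP[/eqP ->|h].
      by rewrite /dpair /= eq_sym.
    by apply: d; rewrite inE h orbT.
  - by rewrite e eqxx in ij.
move=> _; rewrite -(inord_val i) -(inord_val j).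
have ij : (i < j < 4)%N by rewrite lt /=.
have [i4 j4] : (i < 4)%N /\ (j < 4)%N by [].
have [p [q [p2 q2 hpq]]] := theta_tperm ij (msymD (tperm (inord i) (inord j)))
  (msymM (tperm (inord i) (inord j))) (fun k => @tperm_var i j k i4 j4).
exists (tperm (inord p) (inord q)) => k.
have k2 : (k <= 2)%N by rewrite -ltnS.
rewrite -[in RHS](inord_val k) tperm_inord // theta_inord; first exact: hpq.
by case: ifP => _ //; case: ifP.
Qed.

Lemma sum_ord3 (V : nmodType) (F : 'I_3 -> V) :
  \sum_i F i = F (inord 0) + F (inord 1) + F (inord 2).
Proof.
rewrite !big_ord_recr big_ord0 /= add0r.
by congr (_ + _ + _); congr F; apply/val_inj; rewrite /= inordK.
Qed.

Lemma ord3_ind (P : 'I_3 -> Prop) : P (inord 0) -> P (inord 1) -> P (inord 2) -> forall i, P i.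
Proof.
move=> P0 P1 P2 i; rewrite -(inord_val i).
by case: i => [[|[|[|//]]] lt].
Qed.

Lemma eval_theta1 (x y z t : CC) : theta1.@[pt x y z t] = x * y + z * t.
Proof. by rewrite mevalD !mevalM !eval_var. Qed.

Lemma eval_theta2 (x y z t : CC) : theta2.@[pt x y z t] = x * z + y * t.
Proof. by rewrite mevalD !mevalM !eval_var. Qed.

Lemma eval_theta3 (x y z t : CC) : theta3.@[pt x y z t] = x * t + y * z.
Proof. by rewrite mevalD !mevalM !eval_var. Qed.

Lemma eval_specht1 (x y z t : CC) : specht1.@[pt x y z t] = (x - z) * (y - t).
Proof. by rewrite mevalM !mevalB !eval_var. Qed.

Lemma eval_specht2 (x y z t : CC) : specht2.@[pt x y z t] = (x - y) * (z - t).
Proof. by rewrite mevalM !mevalB !eval_var. Qed.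

Lemma eval_resolvent1 (A B : poly4) (x y z t : CC) :
  (specht1 * (A + B * (theta1 + theta3))).@[pt x y z t] = (x - z) * (y - t) *
  (A.@[pt x y z t] + B.@[pt x y z t] * (x * y + z * t + (x * t + y * z))).
Proof. by rewrite mevalM eval_specht1 mevalD mevalM mevalD eval_theta1 eval_theta3. Qed.

Lemma eval_resolvent2 (A B : poly4) (x y z t : CC) :
  (specht2 * (A + B * (theta2 + theta3))).@[pt x y z t] = (x - y) * (z - t) *
  (A.@[pt x y z t] + B.@[pt x y z t] * (x * z + y * t + (x * t + y * z))).
Proof. by rewrite mevalM eval_specht2 mevalD mevalM mevalD eval_theta2 eval_theta3. Qed.

Lemma scale_comb3 (R : pzRingType) (V : lmodType R) (a b : R) (x y z : V) :
  a *: (x - z) + b *: (y - z) = a *: x + b *: y + (- a - b) *: z.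
Proof. by rewrite !scalerBr scalerBl scaleNr addrACA. Qed.

Section Build.

Variables A B : poly4.
Hypotheses (sA : A \is symmetric) (sB : B \is symmetric).

(** The [w i] are permuted exactly as the [theta i], and [g1], [g2] are their differences because
    [theta_i^2 - theta_j^2] factors. The triples [lam] are the coefficients of sum zero. *)
Let w (i : 'I_3) : poly4 := A * theta i + B * (theta i * theta i).
Let g1 := specht1 * (A + B * (theta1 + theta3)).
Let g2 := specht2 * (A + B * (theta2 + theta3)).
Let lam (c1 c2 : CC) (i : 'I_3) : CC := nth 0 [:: c1; c2; - c1 - c2] i.

Let lamE (c1 c2 : CC) (k : nat) : (k <= 2)%N -> lam c1 c2 (inord k) = [:: c1; c2; - c1 - c2]`_k.
Proof. by move=> k2; rewrite /lam inordK. Qed.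

Let sum_w (c1 c2 : CC) : c1 *: g1 + c2 *: g2 = \sum_i lam c1 c2 i *: w i.
Proof.
rewrite sum_ord3 !lamE //= -scale_comb3; congr (_ *: _ + _ *: _);
  rewrite /w !theta_inord //= /g1 /g2 ?specht1E ?specht2E;
  by move: theta1 theta2 theta3 A B => x y z a b; ring.
Qed.

Let sum_theta (c1 c2 : CC) : c1 *: specht1 + c2 *: specht2 = \sum_i lam c1 c2 i *: theta i.
Proof. by rewrite sum_ord3 !lamE //= -scale_comb3 !theta_inord // specht1E specht2E. Qed.

Let msym_sum (s : 'S_4) (u : 'S_3) (f : 'I_3 -> poly4) (l : 'I_3 -> CC) :
  (forall i, msym s (f i) = f (u i)) ->
  msym s (\sum_i l i *: f i) = \sum_i l ((u^-1)%g i) *: f i.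
Proof.
move=> h; rewrite raddf_sum [RHS](reindex_inj (@perm_inj _ u)) /=.
by apply: eq_bigr => i _; rewrite msymZ h permK.
Qed.

Let msym_w (s : 'S_4) (u : 'S_3) : (forall i, msym s (theta i) = theta (u i)) ->
  forall i, msym s (w i) = w (u i).
Proof.
move=> h i; rewrite /w msymD !msymM h.
by rewrite (issymP _ sA) (issymP _ sB).
Qed.

Let theta_free (l l' : 'I_3 -> CC) :
  \sum_i l i *: theta i = \sum_i l' i *: theta i -> l =1 l'.
Proof.
move=> h i.
have e (l0 : 'I_3 -> CC) (x y z t : CC) : (\sum_i l0 i *: theta i).@[pt x y z t] =
   l0 (inord 0) * (x * y + z * t) + l0 (inord 1) * (x * z + y * t) +
   l0 (inord 2) * (x * t + y * z).
  rewrite sum_ord3 !theta_inord //= !mevalD !mevalZ.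
  by rewrite (eval_theta1 x) (eval_theta2 x) (eval_theta3 x).
have h' x y z t := congr1 (meval (pt x y z t)) h.
have := (h' 1 1 0 0, h' 1 0 1 0, h' 1 0 0 1); rewrite !e !(mul0r, mulr0, mul1r, mulr1, add0r, addr0).
by case=> [[h0 h1] h2]; move: i; apply: ord3_ind.
Qed.

Hypothesis AB : A.@[pt 1 1 0 0] + B.@[pt 1 1 0 0] != 0.

(** At [(1,1,0,0)] only [g1] survives and at [(1,0,1,0)] only [g2], each with the value of
    [A + B]. *)
Let g_free (c1 c2 : CC) : c1 *: g1 + c2 *: g2 = 0 -> c1 = 0 /\ c2 = 0.
Proof.
move=> h.
have e x y z t := congr1 (meval (pt x y z t)) h.
have {}e x y z t : c1 * ((x - z) * (y - t) *
  (A.@[pt x y z t] + B.@[pt x y z t] * (x * y + z * t + (x * t + y * z)))) +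
  c2 * ((x - y) * (z - t) *
  (A.@[pt x y z t] + B.@[pt x y z t] * (x * z + y * t + (x * t + y * z)))) = 0.
  rewrite -(eval_resolvent1 A B x y z t) -(eval_resolvent2 A B x y z t) -(mevalZ _ c1) -(mevalZ _ c2) -mevalD.
  by rewrite e meval0.
move: (e 1 1 0 0) (e 1 0 1 0).
rewrite (sym_swap12 1 0 1 0 sA) (sym_swap12 1 0 1 0 sB); move: AB.
move: (A.@[_]) (B.@[_]) => a b ab.
rewrite !(mul0r, mulr0, mul1r, mulr1, add0r, addr0, subr0, subrr).
by move=> /eqP + /eqP; rewrite !mulf_eq0 !(negbTE ab) ?orbF => /eqP -> /eqP ->.
Qed.

Lemma type_S22_resolvent : type_S22 g1 g2.
Proof.
split; first exact: g_free.
split.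
  move=> s c1 c2; have [u hu] := msym_theta s.
  pose l i := lam c1 c2 ((u^-1)%g i).
  exists (l (inord 0)), (l (inord 1)).
  rewrite sum_w (msym_sum _ (msym_w hu)) sum_w; apply: eq_bigr => i _; congr (_ *: _).
  (* Permuting the coefficients keeps their sum zero, so the third is determined by the first two
     and [l] is again of the form [lam]. *)
  have : \sum_i l i = 0.
    have -> : \sum_i l i = \sum_i lam c1 c2 i by rewrite [RHS](reindex_inj (@perm_inj _ (u^-1)%g)).
    by rewrite sum_ord3 !lamE //=; ring.
  rewrite sum_ord3 => tot; rewrite -[lam c1 c2 _]/(l i).
  move: i; apply: ord3_ind; rewrite !lamE //=.
  by apply/eqP; rewrite -subr_eq0 -[X in _ == X]tot; apply/eqP; ring.
exists g1, g2; split.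
  exists 1, 0, 0, 1; split; first by rewrite (scale1r g1) (scale0r g2) addr0.
  by rewrite (scale0r g1) (scale1r g2) add0r mulr1 mulr0 subr0 oner_neq0.
move=> s c1 c2 d1 d2; have [u hu] := msym_theta s.
rewrite !sum_theta !sum_w (msym_sum _ hu) (msym_sum _ (msym_w hu)) => /theta_free e.
by apply: eq_bigr => i _; rewrite e.
Qed.

End Build.

(** * Common zeros of the resolvent pair *)

Lemma pt_scale (p : poly4) (k : nat) (s x y z w : CC) : p \is k.-homog ->
  p.@[pt (s * x) (s * y) (s * z) (s * w)] = s ^+ k * p.@[pt x y z w].
Proof.
move=> hp; rewrite -(meval_scale s _ hp); apply: meval_eq.
by move=> -[[|[|[|[|//]]]] lt].
Qed.

Lemma theta_homog :
  [/\ theta1 \is 2.-homog, theta2 \is 2.-homog & theta3 \is 2.-homog].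
Proof.
have hv i : var i \is 1.-homog by rewrite dhomogX /= mdeg1.
have hvv i j : var i * var j \is 2.-homog by exact: (dhomogM (hv i) (hv j)).
by split; apply: dhomogD.
Qed.

Lemma specht_homog : specht1 \is 2.-homog /\ specht2 \is 2.-homog.
Proof. by case: theta_homog => ? ? ?; rewrite specht1E specht2E; split; apply: rpredB. Qed.

Section ZeroSet.

Variables (k c d : nat) (A B f1 f2 : poly4).
Hypotheses (sA : A \is symmetric) (sB : B \is symmetric).
Hypotheses (s1 : f1 \is symmetric) (s2 : f2 \is symmetric).
Hypotheses (hA : A \is k.-homog) (hB : B = 0 \/ exists l, k = l.+2 /\ B \is l.-homog).
Hypotheses (hf1 : f1 \is c.-homog) (hf2 : f2 \is d.-homog).

(** One hypothesis for each kind of point, up to permutation and scaling: zeros of both [A] and [B],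
    three coordinates zero, three equal coordinates, and [(s,s,u,v)] with [s = 0] or [s = 1]. *)
Hypothesis zeros_generic : forall v, A.@[v] = 0 -> B.@[v] = 0 -> f1.@[v] = 0 -> f2.@[v] = 0 ->
  forall i, v i = 0.
Hypothesis zeros_0001 : f1.@[pt 0 0 0 1] = 0 -> f2.@[pt 0 0 0 1] = 0 -> False.
Hypothesis zeros_111t : forall t, f1.@[pt 1 1 1 t] = 0 -> f2.@[pt 1 1 1 t] = 0 -> False.
Hypothesis zeros_00uv : forall u v, u != 0 -> v != 0 ->
  A.@[pt 0 0 u v] + B.@[pt 0 0 u v] * (u * v) = 0 ->
  f1.@[pt 0 0 u v] = 0 -> f2.@[pt 0 0 u v] = 0 -> False.
Hypothesis zeros_11uv : forall u v,
  A.@[pt 1 1 u v] + B.@[pt 1 1 u v] * ((1 + u) * (1 + v)) = 0 ->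
  f1.@[pt 1 1 u v] = 0 -> f2.@[pt 1 1 u v] = 0 -> False.

Let zero_on_axis t : f1.@[pt 0 0 0 t] = 0 -> f2.@[pt 0 0 0 t] = 0 -> t = 0.
Proof.
have sc p l : p \is l.-homog -> t != 0 -> p.@[pt 0 0 0 t] = 0 -> p.@[pt 0 0 0 1] = 0.
  move=> hp t0 pt0; have := pt_scale t 0 0 0 1 hp; rewrite !mulr0 mulr1 pt0 => /esym/eqP.
  by rewrite mulf_eq0 expf_eq0 (negbTE t0) andbF => /eqP.
move=> h1 h2; apply/eqP/negPn/negP => t0.
exact: (zeros_0001 (sc _ _ hf1 t0 h1) (sc _ _ hf2 t0 h2)).
Qed.

Let zero_on_pair s u v :
  (s - u) * (s - v) * (A.@[pt s s u v] + B.@[pt s s u v] * ((s + u) * (s + v))) = 0 ->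
  f1.@[pt s s u v] = 0 -> f2.@[pt s s u v] = 0 -> [/\ s = 0, u = 0 & v = 0].
Proof.
have [->|s0] := eqVneq s 0.
  have [->|u0] := eqVneq u 0; first by move=> _ h1 h2; rewrite (zero_on_axis h1 h2).
  have [->|v0] := eqVneq v 0.
    by rewrite (sym_swap23 _ _ _ _ s1) (sym_swap23 _ _ _ _ s2) => _ h1 h2;
       rewrite (zero_on_axis h1 h2).
  move=> /eqP; rewrite !sub0r !add0r !mulf_eq0 !oppr_eq0 (negbTE u0) (negbTE v0) /= => /eqP h h1 h2.
  by case: (zeros_00uv u0 v0 h h1 h2).
have -> : u = s * (u / s) by rewrite mulrC divfK.
have -> : v = s * (v / s) by rewrite mulrC divfK.
move: (u / s) (v / s) => {}u {}v.
have sc p l : p \is l.-homog -> p.@[pt s s (s * u) (s * v)] = s ^+ l * p.@[pt 1 1 u v].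
  by move=> hp; rewrite -(pt_scale _ _ _ _ _ hp) mulr1.
have sc0 p l : p \is l.-homog -> p.@[pt s s (s * u) (s * v)] = 0 -> p.@[pt 1 1 u v] = 0.
  by move=> /sc -> /eqP; rewrite mulf_eq0 expf_eq0 (negbTE s0) andbF => /eqP.
have fact w : s - s * w = s * (1 - w) by ring.
rewrite !fact => /eqP; rewrite !mulf_eq0 (negbTE s0) /= !subr_eq0.
move=> + /(sc0 _ _ hf1) h1 /(sc0 _ _ hf2) h2; rewrite -orbA => /or3P[/eqP u1|/eqP v1|].
- by rewrite -u1 in h1 h2; case: (zeros_111t h1 h2).
- rewrite -v1 (sym_swap23 _ _ _ _ s1) in h1; rewrite -v1 (sym_swap23 _ _ _ _ s2) in h2.
  by case: (zeros_111t h1 h2).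
move=> h; suff: A.@[pt 1 1 u v] + B.@[pt 1 1 u v] * ((1 + u) * (1 + v)) = 0.
  by move=> /zeros_11uv => /(_ h1 h2).
move/eqP: h; rewrite (sc _ _ hA); case: hB => [->|[l [kl hBl]]].
  rewrite !meval0 !mul0r !addr0 => /eqP.
  by rewrite mulf_eq0 expf_eq0 (negbTE s0) andbF => /eqP.
rewrite (sc _ _ hBl) kl !exprS.
move: (A.@[_]) (B.@[_]) (s ^+ l) (expf_neq0 l s0) => a b q q0 h.
apply/eqP; have : s * (s * q) * (a + b * ((1 + u) * (1 + v))) == 0.
  by rewrite -h; apply/eqP; ring.
by rewrite !mulf_eq0 (negbTE q0) (negbTE s0).
Qed.

(** If two coordinates agree, symmetry moves the point to the form [(s,s,u,v)]. If all are distinct,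
    the factors [A + B (theta_i + theta_j)] vanish; their difference is [B] times a nonzero factor,
    so [B = 0] and then [A = 0]. *)
Lemma resolvent_common_zero :
  common_zero_only_origin (specht1 * (A + B * (theta1 + theta3)))
                          (specht2 * (A + B * (theta2 + theta3))) f1 f2.
Proof.
move=> v0 e1 e2 h1 h2 i.
have {}e1 := etrans (esym (eval_pt _ v0)) e1; have {}e2 := etrans (esym (eval_pt _ v0)) e2.
have {}h1 := etrans (esym (eval_pt _ v0)) h1; have {}h2 := etrans (esym (eval_pt _ v0)) h2.
have -> : v0 i = pt (v0 (inord 0)) (v0 (inord 1)) (v0 (inord 2)) (v0 (inord 3)) i.
  by rewrite -(inord_val i); case: i => [[|[|[|[|//]]]] lt]; rewrite /pt ?inordK.
move: e1 e2 h1 h2.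
move: (v0 (inord 0)) (v0 (inord 1)) (v0 (inord 2)) (v0 (inord 3)) => x y z t e1 e2 h1 h2.
have {}e1 := etrans (esym (eval_resolvent1 A B x y z t)) e1.
have {}e2 := etrans (esym (eval_resolvent2 A B x y z t)) e2.
suff h0 : [/\ x = 0, y = 0, z = 0 & t = 0].
  by case: h0 => -> -> -> ->; rewrite /pt; case: i => [[|[|[|[|//]]]] lt].
have ABgen := zeros_generic (v := pt x y z t).
have [exy|nxy] := eqVneq x y.
  subst y.
  suff: [/\ x = 0, z = 0 & t = 0] by case=> -> -> ->.
  by apply: zero_on_pair h1 h2; rewrite -[RHS]e1; ring.
have [ezt|nzt] := eqVneq z t.
  subst t; have sw p : p \is symmetric -> p.@[pt x y z z] = p.@[pt z z x y].
    by move=> sp; rewrite (sym_swap12 _ _ _ _ sp) (sym_swap01 _ _ _ _ sp)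
      (sym_swap23 _ _ _ _ sp) (sym_swap12 _ _ _ _ sp).
  rewrite !sw // in e1 e2 h1 h2 ABgen.
  suff: [/\ z = 0, x = 0 & y = 0] by case=> -> -> ->.
  by apply: zero_on_pair h1 h2; rewrite -[RHS]e1; ring.
have [exz|nxz] := eqVneq x z.
  subst z; have sw p : p \is symmetric -> p.@[pt x y x t] = p.@[pt x x y t].
    by move=> sp; rewrite (sym_swap12 _ _ _ _ sp).
  rewrite !sw // in e1 e2 h1 h2 ABgen.
  suff: [/\ x = 0, y = 0 & t = 0] by case=> -> -> ->.
  by apply: zero_on_pair h1 h2; rewrite -[RHS]e2; ring.
have [eyt|nyt] := eqVneq y t.
  subst t; have sw p : p \is symmetric -> p.@[pt x y z y] = p.@[pt y y x z].
    by move=> sp; rewrite (sym_swap23 _ _ _ _ sp) (sym_swap01 _ _ _ _ sp) (sym_swap12 _ _ _ _ sp).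
  rewrite !sw // in e1 e2 h1 h2 ABgen.
  suff: [/\ y = 0, x = 0 & z = 0] by case=> -> -> ->.
  by apply: zero_on_pair h1 h2; rewrite -[RHS]e2; ring.
(* The difference of the two equations is the third member of the family, [(theta1 - theta2) (A + B
   (theta1 + theta2))]. *)
have e3 : (x - t) * (y - z) *
    (A.@[pt x y z t] + B.@[pt x y z t] * (x * y + z * t + (x * z + y * t))) = 0.
  by rewrite -[RHS](subrr 0) -{1}e1 -e2; ring.
have [ext|nxt] := eqVneq x t.
  subst t; have sw p : p \is symmetric -> p.@[pt x y z x] = p.@[pt x x y z].
    by move=> sp; rewrite (sym_swap23 _ _ _ _ sp) (sym_swap12 _ _ _ _ sp).
  rewrite !sw // in e1 e2 h1 h2 ABgen.
  suff: [/\ x = 0, y = 0 & z = 0] by case=> -> -> ->.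
  by apply: zero_on_pair h1 h2; rewrite -[RHS]oppr0 -[in RHS]e1; ring.
have [eyz|nyz] := eqVneq y z.
  subst z; have sw p : p \is symmetric -> p.@[pt x y y t] = p.@[pt y y x t].
    by move=> sp; rewrite (sym_swap01 _ _ _ _ sp) (sym_swap12 _ _ _ _ sp).
  rewrite !sw // in e1 e2 h1 h2 ABgen.
  suff: [/\ y = 0, x = 0 & t = 0] by case=> -> -> ->.
  by apply: zero_on_pair h1 h2; rewrite -[RHS]oppr0 -[in RHS]e1; ring.
move: e1 e2 e3 ABgen; move: (A.@[_]) (B.@[_]) => a b.
have nz (p q : CC) : p != q -> (p - q == 0) = false by rewrite subr_eq0 => /negbTE.
move=> /eqP + /eqP + /eqP; rewrite !mulf_eq0 !nz //= => /eqP u1 /eqP u2 /eqP u3 gen.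
have b0 : b = 0.
  have : b * ((x - t) * (y - z)) == 0 by apply/eqP; rewrite -[RHS](subrr 0) -{1}u1 -u2; ring.
  by rewrite !mulf_eq0 !nz // !orbF => /eqP.
have a0 : a = 0 by move: u1; rewrite b0 mul0r addr0.
have {}gen := gen a0 b0 h1 h2.
have g j (j4 : (j < 4)%N) := gen (inord j).
move: (g 0 erefl) (g 1 erefl) (g 2 erefl) (g 3 erefl); rewrite /pt !inordK //=.
Qed.


Hypotheses (c0 : f1 != 0) (d0 : f2 != 0).
Hypothesis AB : A.@[pt 1 1 0 0] + B.@[pt 1 1 0 0] != 0.

Lemma regular_seq_of_resolvent :
  exists g1 g2 f1 f2, regular_seq_type_S22_S4_S4 k.+2 c d g1 g2 f1 f2.
Proof.
have ht := theta_homog.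
have hg s t : s \is 2.-homog -> t \is 2.-homog -> s * (A + B * t) \is k.+2.-homog.
  move=> hs h; apply: (dhomogM hs).
  apply: dhomogD => //; case: hB => [->|[l [-> hl]]]; first by rewrite mul0r dhomog0.
  by rewrite -(addn2 l); apply: dhomogM.
have hs := specht_homog.
have tS := type_S22_resolvent sA sB AB.
have [free _] := tS.
exists (specht1 * (A + B * (theta1 + theta3))), (specht2 * (A + B * (theta2 + theta3))), f1, f2.
move: ht hs => [t1 t2 t3] [sp1 sp2].
split; last by split=> //; split=> //; split=> //; exact: resolvent_common_zero.
split; [split|split|by []|by []].
- apply/eqP => g0; have [] := free 1 0; first by rewrite g0 scaler0 scale0r addr0.
  by move/eqP; rewrite oner_eq0.
- by apply: hg => //; apply: dhomogD.
- apply/eqP => g0; have [] := free 0 1; first by rewrite g0 scaler0 scale0r addr0.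
  by move=> _ /eqP; rewrite oner_eq0.
- by apply: hg => //; apply: dhomogD.
Qed.

End ZeroSet.

(** * Degrees forced by a regular sequence *)

Lemma sym_linearE (n : nat) (R : comNzRingType) (p : {mpoly R[n.+1]}) :
  p \is symmetric -> p \is 1.-homog -> exists c, p = c *: \sum_i 'X_i.
Proof.
move=> sp hp.
have e i j : p@_(U_(i)%MM) = p@_(U_(j)%MM).
  rewrite -(msym_coeff U_(i)%MM (tperm i j) sp); congr (p@__).
  apply/mnmP => l; rewrite !mnmE; congr (nat_of_bool _).
  by rewrite -{1}(tpermR i j) (inj_eq (@perm_inj _ _)).
exists p@_(U_(ord0))%MM; apply/mpolyP => m; rewrite mcoeffZ raddf_sum /=.
have [/mdeg1P [i /eqP ->]|m1] := boolP (mdeg m == 1%N).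
  rewrite (bigD1 i) //= mcoeffXU eqxx big1 ?addr0 ?mulr1 // => j ne.
  by rewrite mcoeffXU (negbTE ne).
rewrite (dhomog_nemf_coeff hp m1) big1 ?mulr0 // => i _; rewrite mcoeffX.
by have [e1|//] := eqVneq U_(i)%MM m; rewrite -e1 mdeg1 in m1.
Qed.

Lemma meval_sum_var (x y z w : CC) : (\sum_i 'X_i : poly4).@[pt x y z w] = x + y + z + w.
Proof. by rewrite raddf_sum !big_ord_recr big_ord0 /= !mevalXU add0r. Qed.

Lemma sum_var_sym : (\sum_i 'X_i : poly4) \is symmetric.
Proof.
apply/issymP => s; rewrite raddf_sum [RHS](reindex_inj (@perm_inj _ s)) /=.
by apply: eq_bigr => i _; rewrite msymXU.
Qed.

Lemma sum_var_homog : (\sum_i 'X_i : poly4) \is 1.-homog.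
Proof. by apply: rpred_sum => i _; rewrite dhomogX /= mdeg1. Qed.

Lemma sum_var_neq0 : (\sum_i 'X_i : poly4) != 0.
Proof.
apply/eqP => /(congr1 (meval (pt 1 0 0 0))); rewrite meval_sum_var meval0 !addr0.
by move/eqP; rewrite oner_eq0.
Qed.

Lemma sym_linear_eval0 (p : poly4) (x y z w : CC) : p \is symmetric -> p \is 1.-homog ->
  x + y + z + w = 0 -> p.@[pt x y z w] = 0.
Proof.
move=> sp hp s0; have [c ->] := sym_linearE sp hp.
by rewrite mevalZ meval_sum_var s0 mulr0.
Qed.

Lemma zero_pair_sum0 (d e : nat) (p q : poly4) :
  (0 < d)%N -> (0 < e)%N -> p \is d.-homog -> q \is e.-homog ->
  exists x y z w, [/\ [|| x != 0, y != 0 | z != 0], x + y + z + w = 0,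
    p.@[pt x y z w] = 0 & q.@[pt x y z w] = 0].
Proof.
move=> d0 e0 hp hq.
have [x [y [z [nz [h1 h2]]]]] := homog_pair_zero_in_net (pt 1 0 0 (-1)) (pt 0 1 0 (-1))
   (pt 0 0 1 (-1)) d0 e0 hp hq.
exists x, y, z, (- x - y - z); split=> //; first by ring.
  rewrite -[RHS]h1; apply: meval_eq => -[[|[|[|[|//]]]] lt]; rewrite /pt /=; ring.
rewrite -[RHS]h2; apply: meval_eq => -[[|[|[|[|//]]]] lt]; rewrite /pt /=; ring.
Qed.

(** Homogeneity of [A] and [B] comes from dividing by homogeneous factors: first [h1], [h2] by the
    Specht polynomials, then the difference of the quotients, which is [(theta1 - theta2) * B].
    Zeros pass from [h1], [h2] to [g1], [g2] through the invertible change of basis. *)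
Lemma S22_homog_resolvent (n : nat) (g1 g2 : poly4) :
  g1 \is n.-homog -> g2 \is n.-homog -> type_S22 g1 g2 ->
  exists k A B, [/\ n = k.+2, A \is symmetric, B \is symmetric & A \is k.-homog] /\
    (B = 0 \/ exists l, k = l.+2 /\ B \is l.-homog) /\
    forall v, (specht1 * (A + B * (theta1 + theta3))).@[v] = 0 ->
      (specht2 * (A + B * (theta2 + theta3))).@[v] = 0 -> g1.@[v] = 0 /\ g2.@[v] = 0.
Proof.
move=> hg1 hg2 [free [_ [h1 [h2 [[p [q [r [s [e1 [e2 det]]]]]] equiv]]]]].
have [A [B [sA sB E1 E2]]] := S22_resolvent_form equiv.
have hh1 : h1 \is n.-homog by rewrite e1; apply: rpredD; apply: dhomogZ.
have hh2 : h2 \is n.-homog by rewrite e2; apply: rpredD; apply: dhomogZ.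
have h1_neq0 : h1 != 0.
  apply: contra det => /eqP h0; have [p0 q0] : p = 0 /\ q = 0 by apply: free; rewrite -e1.
  by rewrite p0 q0 !mul0r subrr.
have [t1 t2 t3] := theta_homog; have [hs1 hs2] := specht_homog.
have sp1_neq0 : specht1 != 0 by apply: mulf_neq0; apply: var_sub_neq0.
have sp2_neq0 : specht2 != 0 by apply: mulf_neq0; apply: var_sub_neq0.
have t12_neq0 : theta1 - theta2 != 0.
  have -> : theta1 - theta2 = (var 0 - var 3) * (var 1 - var 2).
    by rewrite /theta1 /theta2; var_ring.
  by apply: mulf_neq0; apply: var_sub_neq0.
set u1 := A + B * (theta1 + theta3) in E1; set u2 := A + B * (theta2 + theta3) in E2.
have := dhomog_quot (r := u1) sp1_neq0 hs1; rewrite -E1 => /(_ _ hh1).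
case: (leqP 2 n) => [a2 hu1|_ /eqP u0]; last by rewrite E1 u0 mulr0 eqxx in h1_neq0.
have := dhomog_quot (r := u2) sp2_neq0 hs2; rewrite -E2 => /(_ _ hh2).
rewrite a2 => hu2.
have hBt : (theta1 - theta2) * B \is (n - 2).-homog.
  have -> : (theta1 - theta2) * B = u1 - u2.
    by rewrite /u1 /u2; move: theta1 theta2 theta3 A B {u1 u2 E1 E2 sA sB hu1 hu2 t12_neq0 t1 t2 t3}
      => x y z b c; ring.
  by apply: rpredB; [exact: hu1|exact: hu2].
have hB : B = 0 \/ exists l, (n - 2)%N = l.+2 /\ B \is l.-homog.
  have := dhomog_quot t12_neq0 (rpredB t1 t2) hBt.
  case: (leqP 2 (n - 2)) => [a4 hB|_ /eqP ->]; [right|by left].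
  by exists (n - 2 - 2)%N; split; [move: a4; clear; lia|exact: hB].
exists (n - 2)%N, A, B; split; [split|split; [exact: hB|]].
- by move: a2; clear; lia.
- exact: sA.
- exact: sB.
- have -> : A = u1 - B * (theta1 + theta3) by rewrite /u1 addrK.
  apply: rpredB; [exact: hu1|case: hB => [->|[l [-> hl]]]; first by rewrite mul0r dhomog0].
  by rewrite -(addn2 l); apply: dhomogM hl _; apply: dhomogD.
move=> v; rewrite -/u1 -/u2 -E1 -E2 e1 e2 => v1 v2.
have {}v1 : p * g1.@[v] + q * g2.@[v] = 0 by rewrite -(mevalZ _ p) -(mevalZ _ q) -mevalD.
have {}v2 : r * g1.@[v] + s * g2.@[v] = 0 by rewrite -(mevalZ _ r) -(mevalZ _ s) -mevalD.
move: (g1.@[v]) (g2.@[v]) v1 v2 => x y v1 v2.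
split; apply: (mulfI det); rewrite mulr0.
  have -> : (p * s - q * r) * x = s * (p * x + q * y) - q * (r * x + s * y) by ring.
  by rewrite v1 v2 !mulr0 subr0.
have -> : (p * s - q * r) * y = p * (r * x + s * y) - r * (p * x + q * y) by ring.
by rewrite v1 v2 !mulr0 subr0.
Qed.

Lemma resolvent_111t (A B : poly4) (t : CC) :
  (specht1 * (A + B * (theta1 + theta3))).@[pt 1 1 1 t] = 0 /\
  (specht2 * (A + B * (theta2 + theta3))).@[pt 1 1 1 t] = 0.
Proof.
by split; [rewrite (eval_resolvent1 A B 1)|rewrite (eval_resolvent2 A B 1)]; rewrite subrr !mul0r.
Qed.

Lemma regular_seq_degrees (a c d : nat) (g1 g2 f1 f2 : poly4) :
  (0 < c)%N -> (0 < d)%N -> regular_seq_type_S22_S4_S4 a c d g1 g2 f1 f2 ->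
  ((a = 2 \/ a = 4) /\ (c, d) <> (1, 1)%N) \/
  ((5 <= a)%N /\ regular_degree_sequence (a - 2) (a - 4) c d).
Proof.
move=> c0 d0 [[[ng1 hg1] [ng2 hg2] [nf1 hf1] [nf2 hf2]] [S22 [s1 [s2 reg]]]].
have [k [A [B [[ak sA sB hA] [hB zeros]]]]] := S22_homog_resolvent hg1 hg2 S22.
(* The point [(1,1,1,-3)] has three equal coordinates, so the copy of the representation vanishes
   there, and sum zero, so symmetric linear forms do too. *)
have not11 : (c, d) <> (1, 1)%N.
  case=> c1 d1; rewrite c1 in hf1; rewrite d1 in hf2.
  have s0 : 1 + 1 + 1 + (-3) = 0 :> CC by ring.
  have [z1 z2] := resolvent_111t A B (-3); have [w1 w2] := zeros _ z1 z2.
  have := reg _ w1 w2 (sym_linear_eval0 s1 hf1 s0) (sym_linear_eval0 s2 hf2 s0) ord0.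
  by move/eqP; rewrite oner_eq0.
have [k3|k3] := leqP 3 k; last first.
  left; split=> //; case: k k3 ak hA hB zeros => [|[|[|//]]] _ ->; [by left| |by right].
  move=> hA hB zeros; exfalso.
  (* For [a = 3], [A] is a multiple of the coordinate sum and [B = 0], so a common zero of [f1],
     [f2] in the hyperplane contradicts regularity. *)
  have B0 : B = 0 by case: hB => // -[l []].
  have [x [y [z [w [nz s0 z1 z2]]]]] := zero_pair_sum0 c0 d0 hf1 hf2.
  have A0 := sym_linear_eval0 sA hA s0.
  have [w1 w2] : g1.@[pt x y z w] = 0 /\ g2.@[pt x y z w] = 0.
    apply: zeros; [rewrite (eval_resolvent1 A B x)|rewrite (eval_resolvent2 A B x)];
      by rewrite A0 B0 meval0 mul0r addr0 mulr0.
  have h := reg _ w1 w2 z1 z2.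
  move: nz; have := (h (inord 0), h (inord 1), h (inord 2)); rewrite /pt !inordK //= => -[[-> ->] ->].
  by rewrite eqxx.
right; split; first by rewrite ak.
(* A zero polynomial is not allowed in a degree sequence; as it vanishes everywhere, replacing it
   can only remove common zeros. *)
pose e1 : poly4 := \sum_i 'X_i.
pose A' := if A == 0 then e1 ^+ k else A.
pose B' := if B == 0 then e1 ^+ (k - 2) else B.
have he m : e1 ^+ m \is m.-homog by rewrite -[m in m.-homog]mul1n; apply: dhomogMn sum_var_homog.
have ne m : e1 ^+ m != 0 by apply: expf_neq0 sum_var_neq0.
have se m : e1 ^+ m \is symmetric by apply: rpredX sum_var_sym.
exists A', B', f1, f2; split; [split=> //|split; [split=> //|]].
- by rewrite /A'; case: ifP.
- by rewrite /B'; case: ifP.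
- by rewrite ak subSS subSS subn0 /A' /homog_of_deg; case: ifP => [_|/negbT]; split.
- rewrite ak 2!subSS /B' /homog_of_deg.
  case: ifP => [_|/negbT B0]; split=> //.
  case: hB => [BB|[l [kl hl]]]; first by rewrite BB eqxx in B0.
  by rewrite kl !subSS subn0.
move=> v vA vB v1 v2 i.
have A0 : A.@[v] = 0 by move: vA; rewrite /A'; case: eqP => [-> _|//]; exact: meval0.
have B0 : B.@[v] = 0 by move: vB; rewrite /B'; case: eqP => [-> _|//]; exact: meval0.
have z (s t : poly4) : (s * (A + B * t)).@[v] = 0.
  by rewrite mevalM mevalD mevalM A0 B0 mul0r addr0 mulr0.
have [w1 w2] := zeros v (z _ _) (z _ _).
exact: reg w1 w2 v1 v2 i.
Qed.

(** * Necessary conditions on regular degree sequences *)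

Lemma CC_root2 (b c : CC) : exists x : CC, x ^+ 2 = b + c * x.
Proof.
have [x hx] := @solve_monicpoly CC 2 (fun i => if i == 0%N then b else c) isT.
by exists x; rewrite hx !big_ord_recr big_ord0 /= add0r expr0 expr1 mulr1.
Qed.

(** Multiplication by [w] permutes the coordinates, so the value is unchanged by the factor
    [w ^+ d], which differs from 1 unless 3 divides [d]. The next two lemmas use a fourth root of
    unity and [-1] in the same way. *)
Lemma sym_eval_cube_roots (d : nat) (p : poly4) (w : CC) : p \is symmetric -> p \is d.-homog ->
  w ^+ 2 + w + 1 = 0 -> ~~ (3 %| d)%N -> p.@[pt 1 w (w ^+ 2) 0] = 0.
Proof.
move=> sp hp hw nd.
have w3 : w ^+ 3 = 1.
  have e : w ^+ 3 - 1 = (w ^+ 2 + w + 1) * (w - 1) by ring.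
  by apply/eqP; rewrite -subr_eq0 e hw mul0r.
have w1 : w != 1.
  by apply: contraNneq (natr_CC_neq0 2) => w1; rewrite -hw w1; apply/eqP; ring.
have w2 : w ^+ 2 != 1.
  apply: contraNneq w1 => e; rewrite -w3 exprS e mulr1 //.
have := pt_scale w 1 w (w ^+ 2) 0 hp; rewrite mulr1 -expr2 -exprS w3 mulr0.
rewrite (sym_swap12 _ _ _ _ sp) (sym_swap01 _ _ _ _ sp) => e.
have : (w ^+ d - 1) * p.@[pt 1 w (w ^+ 2) 0] = 0 by rewrite mulrBl mul1r -e subrr.
move/eqP; rewrite mulf_eq0 subr_eq0 (divn_eq d 3) exprD mulnC exprM w3 expr1n mul1r.
move: nd (ltn_pmod d (isT : 0 < 3)%N); rewrite /dvdn.
by case: (d %% 3)%N => [|[|[|//]]] // _ _; rewrite ?expr1 ?(negbTE w1) ?(negbTE w2) => /eqP.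
Qed.

Lemma sym_eval_fourth_roots (d : nat) (p : poly4) (w : CC) : p \is symmetric -> p \is d.-homog ->
  w ^+ 2 = -1 -> ~~ (4 %| d)%N -> p.@[pt 1 w (-1) (- w)] = 0.
Proof.
move=> sp hp hw nd.
have n1 : (-1 : CC) != 1.
  by apply: contraNneq (natr_CC_neq0 1) => e; rewrite mulr2n -[X in X + _]e addNr.
have w1 : w != 1 by apply: contraNneq n1 => w1; rewrite -hw w1 expr1n.
have w3 : w ^+ 3 = - w by rewrite exprS hw mulrN1.
have w3' : w ^+ 3 != 1.
  by apply: contraNneq n1 => e; rewrite -hw -sqrrN -w3 e expr1n.
have w4 : w ^+ 4 = 1 by rewrite (exprM w 2 2) hw sqrrN expr1n.
have := pt_scale w 1 w (-1) (- w) hp; rewrite mulr1 mulrN1 mulrN -expr2 hw opprK.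
rewrite (sym_swap23 _ _ _ _ sp) (sym_swap12 _ _ _ _ sp) (sym_swap01 _ _ _ _ sp) => e.
have : (w ^+ d - 1) * p.@[pt 1 w (-1) (- w)] = 0 by rewrite mulrBl mul1r -e subrr.
move/eqP; rewrite mulf_eq0 subr_eq0 (divn_eq d 4) exprD mulnC exprM w4 expr1n mul1r.
move: nd (ltn_pmod d (isT : 0 < 4)%N); rewrite /dvdn.
by case: (d %% 4)%N => [|[|[|[|//]]]] // _ _;
  rewrite ?expr1 ?hw ?(negbTE w1) ?(negbTE n1) ?(negbTE w3') => /eqP.
Qed.

Lemma sym_odd_eval0 (d : nat) (p : poly4) (s t : CC) : p \is symmetric -> p \is d.-homog ->
  odd d -> p.@[pt s (- s) t (- t)] = 0.
Proof.
move=> sp hp od.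
have := pt_scale (-1) s (- s) t (- t) hp; rewrite !mulN1r !opprK -signr_odd od expr1 mulN1r.
rewrite (sym_swap01 _ _ _ _ sp) (sym_swap23 _ _ _ _ sp) => /eqP.
rewrite -subr_eq0 opprK -mulr2n -mulr_natl mulf_eq0 (negbTE (natr_CC_neq0 1)) /=.
by move/eqP.
Qed.

Section Necessary.

Variables d1 d2 d3 d4 : nat.
Hypotheses (d1_gt0 : (0 < d1)%N) (d2_gt0 : (0 < d2)%N) (d3_gt0 : (0 < d3)%N) (d4_gt0 : (0 < d4)%N).
Hypothesis reg : regular_degree_sequence d1 d2 d3 d4.

Lemma regular_degree_dvd3 : [|| 3 %| d1, 3 %| d2, 3 %| d3 | 3 %| d4]%N.
Proof.
case: reg => [f1 [f2 [f3 [f4 [[s1 s2 s3 s4] [[[_ h1] [_ h2] [_ h3] [_ h4]] h]]]]]].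
apply/negPn/negP; rewrite !negb_or => /and4P[n1 n2 n3 n4].
have [w hw] := CC_root2 (-1) (-1).
have w0 : w ^+ 2 + w + 1 = 0 by rewrite hw; ring.
have := h _ (sym_eval_cube_roots s1 h1 w0 n1) (sym_eval_cube_roots s2 h2 w0 n2)
  (sym_eval_cube_roots s3 h3 w0 n3) (sym_eval_cube_roots s4 h4 w0 n4) ord0.
by move/eqP; rewrite oner_eq0.
Qed.

Lemma regular_degree_dvd4 : [|| 4 %| d1, 4 %| d2, 4 %| d3 | 4 %| d4]%N.
Proof.
case: reg => [f1 [f2 [f3 [f4 [[s1 s2 s3 s4] [[[_ h1] [_ h2] [_ h3] [_ h4]] h]]]]]].
apply/negPn/negP; rewrite !negb_or => /and4P[n1 n2 n3 n4].
have [w hw] := CC_root2 (-1) 0.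
have w0 : w ^+ 2 = -1 by rewrite hw mul0r addr0.
have := h _ (sym_eval_fourth_roots s1 h1 w0 n1) (sym_eval_fourth_roots s2 h2 w0 n2)
  (sym_eval_fourth_roots s3 h3 w0 n3) (sym_eval_fourth_roots s4 h4 w0 n4) ord0.
by move/eqP; rewrite oner_eq0.
Qed.

(** With three odd degrees, three of the forms vanish on the whole projective line of points
    [(s,-s,t,-t)], and the fourth has a zero on it. *)
Lemma regular_degree_even : odd d1 -> odd d2 -> ~~ odd d3 /\ ~~ odd d4.
Proof.
case: reg => [f1 [f2 [f3 [f4 [[s1 s2 s3 s4] [[[_ h1] [_ h2] [_ h3] [_ h4]] h]]]]]] o1 o2.
have zero n (f : poly4) : (0 < n)%N -> f \is n.-homog ->
    exists s t, (s != 0) || (t != 0) /\ f.@[pt s (- s) t (- t)] = 0.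
  move=> n0 hf; have [s [t [st e]]] := homog_zero_on_line (pt 1 (-1) 0 0) (pt 0 0 1 (-1)) n0 hf.
  exists s, t; split=> //; rewrite -[RHS]e; apply: meval_eq => -[[|[|[|[|//]]]] lt];
    rewrite /pt /=; ring.
have nz s t : (s != 0) || (t != 0) -> (forall i, pt s (- s) t (- t) i = 0) -> False.
  move=> st e; move: st; move: (e (inord 0)) (e (inord 2)); rewrite /pt !inordK //= => -> ->.
  by rewrite eqxx.
split; apply/negP => od.
  have [s [t [st e]]] := zero _ _ d4_gt0 h4.
  exact: (nz s t st (h _ (sym_odd_eval0 s t s1 h1 o1) (sym_odd_eval0 s t s2 h2 o2)
    (sym_odd_eval0 s t s3 h3 od) e)).
have [s [t [st e]]] := zero _ _ d3_gt0 h3.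
exact: (nz s t st (h _ (sym_odd_eval0 s t s1 h1 o1) (sym_odd_eval0 s t s2 h2 o2)
  e (sym_odd_eval0 s t s4 h4 od))).
Qed.

Lemma regular_degree_not11 : (d3, d4) <> (1, 1)%N.
Proof.
case: reg => [f1 [f2 [f3 [f4 [[s1 s2 s3 s4] [[[_ h1] [_ h2] [_ h3] [_ h4]] h]]]]]] [e3 e4].
rewrite e3 in h3; rewrite e4 in h4.
have [x [y [z [w [nz s0 z1 z2]]]]] := zero_pair_sum0 d1_gt0 d2_gt0 h1 h2.
have {}h := h _ z1 z2 (sym_linear_eval0 s3 h3 s0) (sym_linear_eval0 s4 h4 s0).
move: nz; have := (h (inord 0), h (inord 1), h (inord 2)); rewrite /pt !inordK //= => -[[-> ->] ->].
by rewrite eqxx.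
Qed.

End Necessary.

(** * Constructions in even degree *)

Definition E1 : poly4 := var 0 + var 1 + var 2 + var 3.
Definition E2 : poly4 := var 0 * var 1 + var 0 * var 2 + var 0 * var 3 +
  var 1 * var 2 + var 1 * var 3 + var 2 * var 3.
Definition E3 : poly4 := var 0 * var 1 * var 2 + var 0 * var 1 * var 3 +
  var 0 * var 2 * var 3 + var 1 * var 2 * var 3.
Definition E4 : poly4 := var 0 * var 1 * var 2 * var 3.

Lemma elem_sym_tperm (R : comNzRingType) (x : nat -> R) (m : R -> R) (a b : nat) :
  (a < b < 4)%N -> {morph m : y z / y + z} -> {morph m : y z / y * z} ->
  (forall k, (k < 4)%N -> m (x k) = x (if k == a then b else if k == b then a else k)) ->
  let e1 := x 0 + x 1 + x 2 + x 3 in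
  let e2 := x 0 * x 1 + x 0 * x 2 + x 0 * x 3 + x 1 * x 2 + x 1 * x 3 + x 2 * x 3 in
  let e3 := x 0 * x 1 * x 2 + x 0 * x 1 * x 3 + x 0 * x 2 * x 3 + x 1 * x 2 * x 3 in
  let e4 := x 0 * x 1 * x 2 * x 3 in
  [/\ m e1 = e1, m e2 = e2, m e3 = e3 & m e4 = e4].
Proof.
move=> /andP[ab b4] mD mM mx /=.
case: b b4 ab mx => [|[|[|[|b]]]] // _; case: a => [|[|[|a]]] // _ mx;
  split; rewrite !(mD, mM) !mx //=; ring.
Qed.

Lemma elem_sym_symmetric :
  [/\ E1 \is symmetric, E2 \is symmetric, E3 \is symmetric & E4 \is symmetric].
Proof.
have h a b (ab : (a < b < 4)%N) := elem_sym_tperm ab (msymD (tperm (inord a) (inord b)))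
  (msymM (tperm (inord a) (inord b))) (fun k => tperm_var (ltn_trans (andP ab).1 (andP ab).2) (andP ab).2).
by split; apply: symmetric4 => a b /h [].
Qed.

Lemma elem_sym_homog :
  [/\ E1 \is 1.-homog, E2 \is 2.-homog, E3 \is 3.-homog & E4 \is 4.-homog].
Proof.
have hv i : var i \is 1.-homog by rewrite dhomogX /= mdeg1.
have h2 i j : var i * var j \is 2.-homog by exact: (dhomogM (hv i) (hv j)).
have h3 i j k : var i * var j * var k \is 3.-homog by exact: (dhomogM (h2 i j) (hv k)).
split.
- by do 3!(apply: dhomogD; last exact: hv).
- by do 5!(apply: dhomogD; last exact: h2).
- by do 3!(apply: dhomogD; last exact: h3).
exact: (dhomogM (h3 0 1 2) (hv 3)).
Qed.

Lemma eval_E1 (x y z w : CC) : E1.@[pt x y z w] = x + y + z + w.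
Proof. by rewrite !mevalD !eval_var. Qed.

Lemma eval_E2 (x y z w : CC) :
  E2.@[pt x y z w] = x * y + x * z + x * w + y * z + y * w + z * w.
Proof. by rewrite !mevalD !mevalM !eval_var. Qed.

Lemma eval_E3 (x y z w : CC) :
  E3.@[pt x y z w] = x * y * z + x * y * w + x * z * w + y * z * w.
Proof. by rewrite !mevalD !mevalM !eval_var. Qed.

Lemma eval_E4 (x y z w : CC) : E4.@[pt x y z w] = x * y * z * w.
Proof. by rewrite !mevalM !eval_var. Qed.

Lemma pt_val (v : 'I_4 -> CC) (i : 'I_4) :
  v i = pt (v (inord 0)) (v (inord 1)) (v (inord 2)) (v (inord 3)) i.
Proof.
by rewrite -{1}(inord_val i); case: i => [[|[|[|[|//]]]] lt]; rewrite /pt ?inordK.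
Qed.

Lemma vieta4 (v : 'I_4 -> CC) (i : 'I_4) :
  v i ^+ 4 = E1.@[v] * v i ^+ 3 - E2.@[v] * v i ^+ 2 + E3.@[v] * v i - E4.@[v].
Proof.
rewrite (eval_pt E1) (eval_pt E2) (eval_pt E3) (eval_pt E4) (pt_val v i).
rewrite eval_E1 eval_E2 eval_E3 eval_E4.
by case: i => [[|[|[|[|//]]]] lt]; rewrite /pt /=; ring.
Qed.

Lemma elem_sym_zero (v : 'I_4 -> CC) :
  E1.@[v] = 0 -> E2.@[v] = 0 -> E3.@[v] = 0 -> E4.@[v] = 0 -> forall i, v i = 0.
Proof.
move=> e1 e2 e3 e4 i; apply/eqP; rewrite -[_ == 0](expf_eq0 (v i) 4) vieta4.
by rewrite e1 e2 e3 e4 !mul0r !(addr0, subr0).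
Qed.

Lemma poly4_neq0 (p : poly4) (v : 'I_4 -> CC) : p.@[v] != 0 -> p != 0.
Proof. by apply: contraNneq => ->; rewrite meval0. Qed.

Lemma elem_sym_neq0 : [/\ E1 != 0, E2 != 0, E3 != 0 & E4 != 0].
Proof.
split; apply: (@poly4_neq0 _ (pt 1 1 1 1)).
- rewrite eval_E1 (_ : _ + 1 = 4%:R); [exact: natr_CC_neq0|ring].
- rewrite eval_E2 (_ : _ + _ = 6%:R); [exact: natr_CC_neq0|ring].
- rewrite eval_E3 (_ : _ + _ = 4%:R); [exact: natr_CC_neq0|ring].
- by rewrite eval_E4 !mulr1 oner_neq0.
Qed.

Lemma symM (p q : poly4) : p \is symmetric -> q \is symmetric -> p * q \is symmetric.
Proof. by move=> /issymP sp /issymP sq; apply/issymP => s; rewrite msymM sp sq. Qed.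

Lemma symX (p : poly4) (m : nat) : p \is symmetric -> p ^+ m \is symmetric.
Proof. by move=> /issymP sp; apply/issymP => s; rewrite rmorphXn /= sp. Qed.

Lemma pow_homog (d : nat) (p : poly4) (m n : nat) : p \is d.-homog -> n = (d * m)%N ->
  p ^+ m \is n.-homog.
Proof. by move=> hp ->; apply: dhomogMn. Qed.

(* Here [f1 = E2 ^+ i * E3 ^+ j] and [f2 = E1 ^+ d].  The zeros of the form
   [(s,s,u,v)] are, up to scaling, [(0,0,u,-u)], [(1,1,-1,-1)] (where [E3 = 0])
   and [(1,1,u,v)] with [u + v = -2], [u v = 3] (where [E2 = 0]). *)
Section EvenDegree.

Variables (k c d i j : nat) (A B : poly4) (PA PB : CC -> CC -> CC -> CC).
Hypotheses (sA : A \is symmetric) (sB : B \is symmetric).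
Hypotheses (hA : A \is k.-homog) (hB : B = 0 \/ exists l, k = l.+2 /\ B \is l.-homog).
Hypotheses (hc : c = (2 * i + 3 * j)%N) (d_gt0 : (0 < d)%N).
Hypothesis evA : forall v, A.@[v] = PA (E2.@[v]) (E3.@[v]) (E4.@[v]).
Hypothesis evB : forall v, B.@[v] = PB (E2.@[v]) (E3.@[v]) (E4.@[v]).
(** The arguments are [E2], [E3], [E4] at the test points: [P0] is linear independence at
    [(1,1,0,0)], [P1] belongs to [(0,0,u,-u)], [P2] to [(1,1,-1,-1)], where [(1 + u) (1 + v) = 0],
    and [P3] to [u + v = -2], [u v = 3], where this product is 2. *)
Hypothesis P0 : PA 1 0 0 + PB 1 0 0 != 0.
Hypothesis Pgen : forall e2 e3 e4, PA e2 e3 e4 = 0 -> PB e2 e3 e4 = 0 ->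
  ((0 < i)%N && (e2 == 0)) || ((0 < j)%N && (e3 == 0)) -> [/\ e2 = 0, e3 = 0 & e4 = 0].
Hypothesis P1 : forall u, u != 0 -> PA (- u ^+ 2) 0 0 - PB (- u ^+ 2) 0 0 * u ^+ 2 != 0.
Hypothesis P2 : PA (-2) 0 1 != 0.
Hypothesis P3 : (0 < i)%N -> PA 0 4 3 + PB 0 4 3 * 2 != 0.

Lemma even_regular_seq : exists g1 g2 f1 f2, regular_seq_type_S22_S4_S4 k.+2 c d g1 g2 f1 f2.
Proof.
have [y1 y2 y3 y4] := elem_sym_symmetric.
have [h1 h2 h3 h4] := elem_sym_homog.
have [n1 n2 n3 n4] := elem_sym_neq0.
have hf1 : E2 ^+ i * E3 ^+ j \is c.-homog by rewrite hc; apply: dhomogM; apply: dhomogMn.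
have hf2 : E1 ^+ d \is d.-homog by apply: pow_homog h1 _; rewrite mul1n.
have z2 v : (E1 ^+ d).@[v] = 0 -> E1.@[v] = 0.
  by rewrite rmorphXn /= => /eqP; rewrite expf_eq0 d_gt0 => /eqP.
have z1 v : (E2 ^+ i * E3 ^+ j).@[v] = 0 ->
    ((0 < i)%N && (E2.@[v] == 0)) || ((0 < j)%N && (E3.@[v] == 0)).
  by rewrite mevalM !rmorphXn /= => /eqP; rewrite mulf_eq0 !expf_eq0.
apply: (regular_seq_of_resolvent (f1 := E2 ^+ i * E3 ^+ j) (f2 := E1 ^+ d) sA sB _ _ hA hB hf1 hf2).
- exact: symM (symX i y2) (symX j y3).
- exact: symX.
- move=> v; rewrite evA evB => vA vB /z1 vf /z2 v1.
  by have [v2 v3 v4] := Pgen vA vB vf; exact: elem_sym_zero.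
- by move=> _ /z2; rewrite eval_E1 !add0r => /eqP; rewrite oner_eq0.
- move=> t /z1 + /z2; rewrite eval_E1 eval_E2 eval_E3 => + t3.
  have -> : t = -3 by rewrite -[LHS]addr0 -[in LHS](subrr 3) addrA -[RHS]add0r -t3; ring.
  have -> : 1 * 1 + 1 * 1 + 1 * -3 + 1 * 1 + 1 * -3 + 1 * -3 = - 6%:R :> CC by ring.
  have -> : 1 * 1 * 1 + 1 * 1 * -3 + 1 * 1 * -3 + 1 * 1 * -3 = - 8%:R :> CC by ring.
  by rewrite !oppr_eq0 !(negbTE (natr_CC_neq0 _)) !andbF.
- move=> u w u0 w0 + _ /z2; rewrite evA evB eval_E1 eval_E2 eval_E3 eval_E4 => + uw.
  have -> : w = - u by rewrite -[RHS]addr0 -uw; ring.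
  rewrite !(mul0r, mulr0, add0r, addr0) mulrN -expr2 mulrN => /eqP.
  by rewrite (negbTE (P1 u0)).
- move=> u w + /z1 + /z2; rewrite evA evB eval_E1 eval_E2 eval_E3 eval_E4 => + + uw.
  set p := u * w.
  have us : u + w = -2 by rewrite -[RHS]addr0 -uw; ring.
  have -> : 1 * 1 + 1 * u + 1 * w + 1 * u + 1 * w + u * w = p - 3.
    by rewrite /p -[u * w in RHS]addr0 -[in RHS](mulr0 2) -uw; ring.
  have -> : 1 * 1 * u + 1 * 1 * w + 1 * u * w + 1 * u * w = 2 * (p - 1).
    by rewrite /p -[RHS]addr0 -uw; ring.
  have -> : 1 * 1 * u * w = p by rewrite /p; ring.
  have -> : (1 + u) * (1 + w) = p - 1 by rewrite /p -[RHS]addr0 -uw; ring.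
  move=> + /orP[/andP[i0 /eqP p3]|/andP[j0 /eqP p1]].
    have -> : p = 3 by rewrite -[LHS](subrK 3) p3 add0r.
    rewrite subrr (_ : 3 - 1 = 2); last by ring.
    by rewrite (_ : 2 * 2 = 4) => [/eqP|]; [rewrite (negbTE (P3 i0))|ring].
  have -> : p = 1.
    move/eqP: p1; rewrite mulf_eq0 (negbTE (natr_CC_neq0 1)) /= subr_eq0 => /eqP //.
  rewrite subrr !mulr0 addr0 (_ : 1 - 3 = -2); last by ring.
  by move/eqP; rewrite (negbTE P2).
- by apply: mulf_neq0; apply: expf_neq0.
- exact: expf_neq0.
- rewrite evA evB eval_E2 eval_E3 eval_E4 !(mul0r, mulr0, mulr1, add0r, addr0).
  exact: P0.
Qed.

End EvenDegree.

Lemma two_three_decomposition (c : nat) : (2 <= c)%N -> exists i j, c = (2 * i + 3 * j)%N.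
Proof.
move=> c2; exists ((c - 3 * odd c)./2), (odd c); case: (boolP (odd c)) => oc; lia.
Qed.

Lemma symD (p q : poly4) : p \is symmetric -> q \is symmetric -> p + q \is symmetric.
Proof. by move=> /issymP sp /issymP sq; apply/issymP => s; rewrite msymD sp sq. Qed.

Section EvenInstances.

Variables c d i j : nat.
Hypotheses (hc : c = (2 * i + 3 * j)%N) (d_gt0 : (0 < d)%N).

Local Notation goal a := (exists g1 g2 f1 f2, regular_seq_type_S22_S4_S4 a c d g1 g2 f1 f2).

Let sym2 : E2 \is symmetric. Proof. by case: elem_sym_symmetric. Qed.
Let sym3 : E3 \is symmetric. Proof. by case: elem_sym_symmetric. Qed.
Let sym4 : E4 \is symmetric. Proof. by case: elem_sym_symmetric. Qed.
Let hom2 : E2 \is 2.-homog. Proof. by case: elem_sym_homog. Qed.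
Let hom3 : E3 \is 3.-homog. Proof. by case: elem_sym_homog. Qed.
Let hom4 : E4 \is 4.-homog. Proof. by case: elem_sym_homog. Qed.

Let n2 : (2 : CC) != 0 := natr_CC_neq0 1.
Let n3 : (3 : CC) != 0 := natr_CC_neq0 2.

Let eval_pow (p : poly4) (m : nat) (v : 'I_4 -> CC) : (p ^+ m).@[v] = p.@[v] ^+ m.
Proof. exact: rmorphXn. Qed.

Let pow_eq0 (x : CC) (m : nat) : x ^+ m = 0 -> x = 0.
Proof. by move=> /eqP; rewrite expf_eq0 => /andP[_ /eqP]. Qed.

Let pow0 (m : nat) : (0 < m)%N -> 0 ^+ m = 0 :> CC.
Proof. by move=> m0; rewrite expr0n gtn_eqF. Qed.

Let natr_sum_neq0 (x y : nat) : (0 < x + y)%N -> x%:R + y%:R != 0 :> CC.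
Proof. by rewrite -natrD; case: (x + y)%N => // m _; exact: natr_CC_neq0. Qed.

Lemma degree2_instance : goal 2.
Proof.
apply: (even_regular_seq (i := i) (j := j) (A := 1) (B := 0)
  (PA := fun _ _ _ => 1) (PB := fun _ _ _ => 0) _ _ _ _ hc d_gt0).
- by apply/issymP => s; rewrite msym1.
- by apply/issymP => s; rewrite msym0.
- exact: dhomog1.
- by left.
- by move=> v; rewrite meval1.
- by move=> v; rewrite meval0.
- by rewrite addr0 oner_neq0.
- by move=> x y z /eqP; rewrite oner_eq0.
- by move=> u u0; rewrite mul0r subr0 oner_neq0.
- exact: oner_neq0.
- by move=> _; rewrite mul0r addr0 oner_neq0.
Qed.

(* [A = - E2], [B = 3] makes [A + B (1 + u) (1 + v) = 2 u v] when [u + v = -2]. *)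
Lemma degree4_instance : goal 4.
Proof.
apply: (even_regular_seq (i := i) (j := j) (A := - E2) (B := 3%:R)
  (PA := fun x _ _ => - x) (PB := fun _ _ _ => 3%:R) _ _ _ _ hc d_gt0).
- by apply/issymP => s; rewrite msymN (issymP _ sym2).
- by apply/issymP => s; rewrite rmorph_nat.
- by rewrite dhomogN.
- by right; exists 0%N; split=> //; apply: rpredMn; exact: dhomog1.
- by move=> v; rewrite mevalN.
- by move=> v; rewrite rmorph_nat.
- by rewrite (_ : -1 + 3 = 2) //; ring.
- by move=> x y z _ /eqP; rewrite (negbTE n3).
- move=> u u0; rewrite (_ : _ - _ = - (2 * u ^+ 2)); last by ring.
  by rewrite oppr_eq0 mulf_neq0 ?expf_neq0.
- by rewrite opprK.
- by move=> _; rewrite oppr0 add0r mulf_neq0.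
Qed.

(** With [i = 0], [f1] is a power of [E3], so [A] and [B] only have to cut out [E2] and [E4]; of the
    degrees [a - 2], [a - 4], the multiple of 4 takes the power of [E4]. *)
Lemma degree_2mod4_instance (m : nat) : i = 0%N -> (0 < m)%N -> goal (4 * m).+2.
Proof.
move=> i0 m0; have [l ml] : exists l, m = l.+1 by exists m.-1; rewrite prednK.
apply: (even_regular_seq (i := i) (j := j) (A := E4 ^+ m) (B := E2 ^+ (2 * l).+1)
  (PA := fun _ _ z => z ^+ m) (PB := fun x _ _ => x ^+ (2 * l).+1) _ _ _ _ hc d_gt0).
- exact: symX.
- exact: symX.
- exact: (pow_homog hom4).
- by right; exists (4 * l).+2; split; [lia|apply: (pow_homog hom2); lia].
- by move=> v; rewrite eval_pow.
- by move=> v; rewrite eval_pow.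
- by rewrite expr1n expr0n gtn_eqF // add0r oner_neq0.
- move=> x y z /pow_eq0 -> /pow_eq0 ->; rewrite i0 ltnn eqxx /=.
  by move=> /andP[_ /eqP].
- move=> u u0; rewrite expr0n gtn_eqF // sub0r oppr_eq0.
  by rewrite mulf_neq0 ?expf_neq0 ?oppr_eq0 ?expf_neq0.
- by rewrite expr1n oner_neq0.
- by rewrite i0.
Qed.

Lemma degree_0mod4_instance (m : nat) : i = 0%N -> (0 < m)%N -> goal (4 * m).+4.
Proof.
move=> i0 m0.
apply: (even_regular_seq (i := i) (j := j) (A := E2 ^+ (2 * m).+1) (B := E4 ^+ m)
  (PA := fun x _ _ => x ^+ (2 * m).+1) (PB := fun _ _ z => z ^+ m) _ _ _ _ hc d_gt0).
- exact: symX.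
- exact: symX.
- apply: (pow_homog hom2); lia.
- by right; exists (4 * m)%N; split=> //; apply: (pow_homog hom4).
- by move=> v; rewrite eval_pow.
- by move=> v; rewrite eval_pow.
- by rewrite expr1n expr0n gtn_eqF // addr0 oner_neq0.
- move=> x y z /pow_eq0 -> /pow_eq0 ->; rewrite i0 ltnn eqxx /=.
  by move=> /andP[_ /eqP].
- move=> u u0; rewrite expr0n gtn_eqF // mul0r subr0.
  by rewrite !expf_neq0 // oppr_eq0 expf_neq0.
- by rewrite expf_neq0 // oppr_eq0.
- by rewrite i0.
Qed.

(** On [E2 = 0] or [E3 = 0] the sum [A] reduces to a power of the other, so [f1] and [A] force both
    to vanish. Here [a - 2] is a multiple of 6 and [a - 4] of 4; the next lemma exchanges the roles.
    The plus signs make the values in [P3] positive integers. *)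
Lemma degree_8mod12_instance (m : nat) : goal (12 * m + 8).
Proof.
rewrite (_ : 12 * m + 8 = (12 * m + 6).+2)%N; last by lia.
apply: (even_regular_seq (i := i) (j := j) (A := E3 ^+ (4 * m).+2 + E2 ^+ (6 * m).+3)
  (B := E4 ^+ (3 * m).+1) (PA := fun x y _ => y ^+ (4 * m).+2 + x ^+ (6 * m).+3)
  (PB := fun _ _ z => z ^+ (3 * m).+1) _ _ _ _ hc d_gt0).
- by apply: symD; apply: symX.
- exact: symX.
- by apply: rpredD; [apply: (pow_homog hom3)|apply: (pow_homog hom2)]; lia.
- by right; exists (12 * m + 4)%N; split; [lia|apply: (pow_homog hom4); lia].
- by move=> v; rewrite mevalD !eval_pow.
- by move=> v; rewrite eval_pow.
- by rewrite expr1n !expr0n add0r addr0 oner_neq0.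
- move=> x y z + /pow_eq0 -> /orP[|] /andP[_ /eqP e]; rewrite e.
    by rewrite [0 ^+ _]expr0n addr0 => /pow_eq0 ->.
  by rewrite [0 ^+ _]expr0n add0r => /pow_eq0 ->.
- move=> u u0; rewrite ![0 ^+ _]expr0n mul0r subr0 add0r.
  by rewrite !expf_neq0 // oppr_eq0 expf_neq0.
- by rewrite [0 ^+ _]expr0n add0r expf_neq0 // oppr_eq0.
- move=> _; rewrite [0 ^+ _]expr0n addr0 -!natrX -natrM natr_sum_neq0 //.
  by apply: ltn_addr; rewrite expn_gt0.
Qed.

Lemma degree_10mod12_instance (m : nat) : goal (12 * m + 10).
Proof.
rewrite (_ : 12 * m + 10 = (12 * m + 8).+2)%N; last by lia.
apply: (even_regular_seq (i := i) (j := j) (A := E4 ^+ (3 * m).+2)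
  (B := E3 ^+ (4 * m).+2 + E2 ^+ (6 * m).+3) (PA := fun _ _ z => z ^+ (3 * m).+2)
  (PB := fun x y _ => y ^+ (4 * m).+2 + x ^+ (6 * m).+3) _ _ _ _ hc d_gt0).
- exact: symX.
- by apply: symD; apply: symX.
- by apply: (pow_homog hom4); lia.
- right; exists (12 * m + 6)%N; split; first by lia.
  by apply: rpredD; [apply: (pow_homog hom3)|apply: (pow_homog hom2)]; lia.
- by move=> v; rewrite eval_pow.
- by move=> v; rewrite mevalD !eval_pow.
- by rewrite expr1n !expr0n !add0r oner_neq0.
- move=> x y z /pow_eq0 -> + /orP[|] /andP[_ /eqP e]; rewrite e.
    by rewrite [0 ^+ _]expr0n addr0 => /pow_eq0 ->.
  by rewrite [0 ^+ _]expr0n add0r => /pow_eq0 ->.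
- move=> u u0; rewrite ![0 ^+ _]expr0n sub0r add0r oppr_eq0.
  by rewrite mulf_neq0 ?expf_neq0 // oppr_eq0 expf_neq0.
- by rewrite expr1n oner_neq0.
- move=> _; rewrite [0 ^+ _]expr0n addr0 -!natrX -natrM natr_sum_neq0 //.
  by apply: ltn_addr; rewrite expn_gt0.
Qed.

(** Now the multiple of 3 is also the multiple of 4, and the other degree is neither. On [E3 = 0]
    the pair reduces to powers of [E4] and [E2]; on [E2 = 0], [B] says that [E3] or [E4] vanishes
    and [A] that both do. The next lemma exchanges the roles. *)
Lemma degree_2mod12_instance (m : nat) : goal (12 * m + 14).
Proof.
rewrite (_ : 12 * m + 14 = (12 * m + 12).+2)%N; last by lia.
apply: (even_regular_seq (i := i) (j := j) (A := E4 ^+ (3 * m).+3 + E3 ^+ (4 * m).+4)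
  (B := E2 ^+ (6 * m + 5) + E3 ^+ 2 * E4 ^+ (3 * m).+1)
  (PA := fun _ y z => z ^+ (3 * m).+3 + y ^+ (4 * m).+4)
  (PB := fun x y z => x ^+ (6 * m + 5) + y ^+ 2 * z ^+ (3 * m).+1) _ _ _ _ hc d_gt0).
- by apply: symD; apply: symX.
- by apply: symD; [apply: symX|apply: symM; apply: symX].
- by apply: rpredD; [apply: (pow_homog hom4)|apply: (pow_homog hom3)]; lia.
- right; exists (12 * m + 10)%N; split; first by lia.
  apply: rpredD; first by apply: (pow_homog hom2); lia.
  rewrite (_ : 12 * m + 10 = 3 * 2 + 4 * (3 * m).+1)%N; last by lia.
  by apply: dhomogM; apply: dhomogMn.
- by move=> v; rewrite mevalD !eval_pow.
- by move=> v; rewrite mevalD mevalM !eval_pow.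
- by rewrite expr1n !expr0n !(add0r, mul0r, addr0) oner_neq0.
- move=> x y z + + /orP[|] /andP[_ /eqP e]; rewrite e.
    rewrite [0 ^+ (6 * m + 5)]pow0 ?addn_gt0 ?orbT // add0r => h1 /eqP.
    by rewrite mulf_eq0 => /orP[] /eqP /pow_eq0 y0; move: h1; rewrite y0 [0 ^+ _.+1]pow0 //
      ?add0r ?addr0 => /pow_eq0 ->.
  by rewrite ![0 ^+ _.+1]pow0 // mul0r !addr0 => /pow_eq0 -> /pow_eq0 ->.
- move=> u u0; rewrite [0 ^+ 2]expr0n mul0r addr0 ![0 ^+ _.+1]expr0n addr0 sub0r oppr_eq0.
  by rewrite mulf_neq0 ?expf_neq0 // oppr_eq0 expf_neq0.
- by rewrite expr1n expr0n addr0 oner_neq0.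
- move=> _; rewrite [0 ^+ (6 * m + 5)]pow0 ?addn_gt0 ?orbT // add0r -!natrX -natrM -!natrD -natrM natr_sum_neq0 //.
  by do 2!apply: ltn_addr; rewrite expn_gt0.
Qed.

Lemma degree_4mod12_instance (m : nat) : goal (12 * m + 16).
Proof.
rewrite (_ : 12 * m + 16 = (12 * m + 14).+2)%N; last by lia.
apply: (even_regular_seq (i := i) (j := j) (A := E2 ^+ (6 * m + 7) + E3 ^+ 2 * E4 ^+ (3 * m).+2)
  (B := E4 ^+ (3 * m).+3 + E3 ^+ (4 * m).+4)
  (PA := fun x y z => x ^+ (6 * m + 7) + y ^+ 2 * z ^+ (3 * m).+2)
  (PB := fun _ y z => z ^+ (3 * m).+3 + y ^+ (4 * m).+4) _ _ _ _ hc d_gt0).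
- by apply: symD; [apply: symX|apply: symM; apply: symX].
- by apply: symD; apply: symX.
- apply: rpredD; first by apply: (pow_homog hom2); lia.
  rewrite (_ : 12 * m + 14 = 3 * 2 + 4 * (3 * m).+2)%N; last by lia.
  by apply: dhomogM; apply: dhomogMn.
- right; exists (12 * m + 12)%N; split; first by lia.
  by apply: rpredD; [apply: (pow_homog hom4)|apply: (pow_homog hom3)]; lia.
- by move=> v; rewrite mevalD mevalM !eval_pow.
- by move=> v; rewrite mevalD !eval_pow.
- by rewrite expr1n !expr0n !(add0r, mul0r, addr0) oner_neq0.
- move=> x y z + + /orP[|] /andP[_ /eqP e]; rewrite e.
    rewrite [0 ^+ (6 * m + 7)]pow0 ?addn_gt0 ?orbT // add0r => /eqP + h1.
    by rewrite mulf_eq0 => /orP[] /eqP /pow_eq0 y0; move: h1; rewrite y0 [0 ^+ _.+1]pow0 //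
      ?add0r ?addr0 => /pow_eq0 ->.
  by rewrite ![0 ^+ _.+1]pow0 // mul0r !addr0 => /pow_eq0 -> /pow_eq0 ->.
- move=> u u0; rewrite [0 ^+ 2]expr0n mul0r addr0 ![0 ^+ _.+1]expr0n addr0 mul0r subr0.
  by rewrite !expf_neq0 // oppr_eq0 expf_neq0.
- by rewrite expr0n mul0r addr0 expf_neq0 // oppr_eq0.
- move=> _; rewrite [0 ^+ (6 * m + 7)]pow0 ?addn_gt0 ?orbT // add0r -!natrX -natrM -!natrD -natrM natr_sum_neq0 //.
  by apply: ltn_addr; rewrite muln_gt0 !expn_gt0.
Qed.

End EvenInstances.

(** The divisibility hypothesis excludes the residues 0 and 6; the residues 2 and 4 start at 14 and
    16 because [a > 4]. *)
Lemma even_mod12_cases (a : nat) : (4 < a)%N -> ~~ odd a -> (3 %| a - 2)%N || (3 %| a - 4)%N ->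
  exists m, (a = 12 * m + 8 \/ a = 12 * m + 10 \/ a = 12 * m + 14 \/ a = 12 * m + 16)%N.
Proof.
move=> a4 ae h.
have : (a %% 12 = 8 \/ a %% 12 = 10 \/ a %% 12 = 2 \/ a %% 12 = 4)%N by lia.
case=> [r|[r|[r|r]]].
- by exists (a %/ 12)%N; lia.
- by exists (a %/ 12)%N; lia.
- by exists (a %/ 12).-1%N; lia.
- by exists (a %/ 12).-1%N; lia.
Qed.

(** If [a <= 4] or 3 divides [a - 2] or [a - 4], any [c >= 2] of the form [2 i + 3 j] will do, and
    [(c, d) <> (1, 1)] provides one after a swap. Otherwise 3 divides [c] or [d], and that form is a
    power of [E3]. *)
Lemma even_degree_exists (a c d : nat) : (2 <= a)%N -> ~~ odd a -> (0 < c)%N -> (0 < d)%N ->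
  (c, d) <> (1, 1)%N ->
  (a <= 4)%N || [|| 3 %| a - 2, 3 %| a - 4, 3 %| c | 3 %| d]%N ->
  exists g1 g2 f1 f2, regular_seq_type_S22_S4_S4 a c d g1 g2 f1 f2.
Proof.
move=> a2 ae.
have swap x y : (exists g1 g2 f1 f2, regular_seq_type_S22_S4_S4 a x y g1 g2 f1 f2) ->
    exists g1 g2 f1 f2, regular_seq_type_S22_S4_S4 a y x g1 g2 f1 f2.
  move=> [g1 [g2 [f1 [f2 [[h1 h2 h3 h4] [S [s1 [s2 z]]]]]]]].
  exists g1, g2, f2, f1; split=> //; split=> //; split=> //; split=> // v v1 v2 v3 v4.
  exact: z v1 v2 v4 v3.
have main x y : (2 <= x)%N -> (0 < y)%N -> ((a <= 4) || (3 %| a - 2) || (3 %| a - 4))%N ->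
    exists g1 g2 f1 f2, regular_seq_type_S22_S4_S4 a x y g1 g2 f1 f2.
  move=> x2 y0 h; have [i [j xij]] := two_three_decomposition x2.
  have [->|an2] := eqVneq a 2; first exact: degree2_instance xij y0.
  have [->|an4] := eqVneq a 4; first exact: degree4_instance xij y0.
  have a4 : (4 < a)%N by move: a2 ae an2 an4; clear; lia.
  have h' : (3 %| a - 2)%N || (3 %| a - 4)%N by move: h; rewrite leqNgt a4.
  have [m [->|[->|[->|->]]]] := even_mod12_cases a4 ae h'.
  - exact: degree_8mod12_instance xij y0 m.
  - exact: degree_10mod12_instance xij y0 m.
  - exact: degree_2mod12_instance xij y0 m.
  - exact: degree_4mod12_instance xij y0 m.
have main3 x y : (3 %| x)%N -> (0 < x)%N -> (0 < y)%N -> (4 < a)%N ->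
    exists g1 g2 f1 f2, regular_seq_type_S22_S4_S4 a x y g1 g2 f1 f2.
  move=> /dvdnP [j xj] x0 y0 a4; have xij : x = (2 * 0 + 3 * j)%N by lia.
  have [m [m0 [->|->]]] : exists m, (0 < m)%N /\ (a = (4 * m).+2 \/ a = (4 * m).+4)%N.
    exists ((a - 2) %/ 4)%N; lia.
  - exact: degree_2mod4_instance xij y0 m erefl m0.
  - exact: degree_0mod4_instance xij y0 m erefl m0.
move=> c0 d0 cd h.
have [h'|h'] := boolP ((a <= 4) || (3 %| a - 2) || (3 %| a - 4))%N.
  have [c2|c1] := leqP 2 c; first exact: main.
  have [d2|d1] := leqP 2 d; first by apply: swap; exact: main.
  by case: cd; congr (_, _); lia.
have [a4 /orP[c3|d3]] : (4 < a)%N /\ ((3 %| c) || (3 %| d))%N by lia.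
  exact: main3.
by apply: swap; exact: main3.
Qed.

(** * Constructions in odd degree *)

(** In this partial order, being nonnegative includes being real. *)
Definition nneg (x : CC) : bool := (0 : CCnum) <= x.

Lemma nneg_natr (n : nat) : nneg n%:R.
Proof. exact (Num.Theory.ler0n CCnum n). Qed.

Lemma nnegD (x y : CC) : nneg x -> nneg y -> nneg (x + y).
Proof. exact (@Num.Theory.addr_ge0 CCnum x y). Qed.

Lemma nnegM (x y : CC) : nneg x -> nneg y -> nneg (x * y).
Proof. exact (@Num.Theory.mulr_ge0 CCnum x y). Qed.

Lemma nnegX (x : CC) (n : nat) : nneg x -> nneg (x ^+ n).
Proof. exact (@Num.Theory.exprn_ge0 CCnum n x). Qed.

Lemma numDomain_pos_sum_neq0 (R : numDomainType) (x y : R) : 0 < x -> 0 <= y -> x + y != 0.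
Proof. by move=> x0 y0; rewrite Num.Theory.lt0r_neq0 // Num.Theory.ltr_wpDr. Qed.

Lemma numDomain_pow_pos (R : numDomainType) (x y : R) (n : nat) :
  0 <= x -> 0 <= y -> 0 < (1 + 1 + x + y) ^+ n.
Proof.
move=> x0 y0; apply: Num.Theory.exprn_gt0.
by do 2!apply: Num.Theory.ltr_wpDr => //; apply: Num.Theory.addr_gt0; exact: Num.Theory.ltr01.
Qed.

Lemma nneg_pow_sum_neq0 (u v m q : CC) (n : nat) : nneg u -> nneg v -> nneg m ->
  q = 1 + (u + v + u * v) ->
  m + (1 + 1 + u + v) ^+ n * q != 0 /\ (1 + 1 + u + v) ^+ n + m * q != 0.
Proof.
move=> hu hv hm ->.
have huv : nneg (u + v + u * v) by apply: nnegD; [apply: nnegD|apply: nnegM].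
have := @numDomain_pow_pos CCnum u v n hu hv.
have hq : (0 : CCnum) < 1 + (u + v + u * v).
  by apply: Num.Theory.ltr_wpDr; [exact: huv|exact: Num.Theory.ltr01].
set s := (_ ^+ n) => s0; split.
  rewrite addrC; apply: (@numDomain_pos_sum_neq0 CCnum) => //.
  exact: (@Num.Theory.mulr_gt0 CCnum).
apply: (@numDomain_pos_sum_neq0 CCnum) => //.
by apply: (@Num.Theory.mulr_ge0 CCnum) => //; exact: Order.PreorderTheory.ltW.
Qed.

(** The square of [2 a v - b] is the discriminant, a natural number, so [v] is real; then
    [b v = a v^2 + c] is nonnegative. *)
Lemma real_quadratic_root_ge0 (R : numFieldType) (a b c : nat) (v : R) :
  (0 < a)%N -> (0 < b)%N -> (4 * a * c <= b ^ 2)%N ->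
  a%:R * v ^+ 2 - b%:R * v + c%:R = 0 -> 0 <= v.
Proof.
move=> a0 b0 disc e.
have an : (2 * a%:R : R) != 0 by rewrite mulf_neq0 ?Num.Theory.pnatr_eq0 // -lt0n.
have sq : (2 * a%:R * v - b%:R) ^+ 2 = (b ^ 2 - 4 * a * c)%:R.
  rewrite natrB // natrX !natrM -[LHS]subr0 -(mulr0 (4 * a%:R)) -e; ring.
have r1 : 2 * a%:R * v - b%:R \is Num.real by rewrite Num.Theory.realEsqr sq Num.Theory.ler0n.
have vr : v \is Num.real.
  have -> : v = (2 * a%:R * v - b%:R + b%:R) / (2 * a%:R) by rewrite subrK mulrAC divff ?mul1r.
  by apply: rpred_div; [exact: rpredD r1 (rpred_nat _ _)|apply: rpredM; exact: rpred_nat].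
have v2 : 0 <= v ^+ 2 by rewrite -Num.Theory.realEsqr.
have bv : b%:R * v = a%:R * v ^+ 2 + c%:R by rewrite -[LHS]addr0 -e; ring.
have bp : (0 : R) < b%:R by rewrite Num.Theory.ltr0n.
rewrite -(Num.Theory.pmulr_rge0 _ bp) bv; apply: Num.Theory.addr_ge0.
  by apply: Num.Theory.mulr_ge0 => //; apply: Num.Theory.ler0n.
exact: Num.Theory.ler0n.
Qed.

Lemma nneg_quadratic (a b c : nat) (v : CC) :
  (0 < a)%N -> (0 < b)%N -> (4 * a * c <= b ^ 2)%N ->
  a%:R * v ^+ 2 - b%:R * v + c%:R = 0 -> nneg v.
Proof. exact (@real_quadratic_root_ge0 CCnum a b c v). Qed.

(** [M] is the member of the pair [A], [B] that is not the power of [E1]. Its vanishing at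
    [(0,0,u,v)] leaves only [v = - u] to treat there. At [(1,1,u,v)] with [u], [v] nonnegative,
    [E1 = 2 + u + v] is positive and [M] nonnegative. *)
Section OddDegree.

Variables (k l c d : nat) (A B M f1 f2 : poly4).
Hypotheses (kl : k = l.+2) (sM : M \is symmetric).
Hypothesis AB : (A = M /\ B = E1 ^+ l) /\ M \is k.-homog \/
  (A = E1 ^+ k /\ B = M) /\ M \is l.-homog.
Hypothesis M_00uv : forall u v, M.@[pt 0 0 u v] = 0.
Hypothesis M_ge0 : forall u v, nneg u -> nneg v -> nneg M.@[pt 1 1 u v].
Hypotheses (s1 : f1 \is symmetric) (s2 : f2 \is symmetric).
Hypotheses (h1 : f1 \is c.-homog) (h2 : f2 \is d.-homog) (f1_neq0 : f1 != 0) (f2_neq0 : f2 != 0).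
Hypothesis Fgen : forall v, E1.@[v] = 0 -> M.@[v] = 0 -> f1.@[v] = 0 -> f2.@[v] = 0 ->
  forall i, v i = 0.
Hypothesis F0001 : f1.@[pt 0 0 0 1] = 0 -> f2.@[pt 0 0 0 1] = 0 -> False.
Hypothesis F111t : forall t, f1.@[pt 1 1 1 t] = 0 -> f2.@[pt 1 1 1 t] = 0 -> False.
Hypothesis F00 : forall u, u != 0 -> f1.@[pt 0 0 u (- u)] = 0 -> f2.@[pt 0 0 u (- u)] = 0 -> False.
Hypothesis Fpos : forall u v, f1.@[pt 1 1 u v] = 0 -> f2.@[pt 1 1 u v] = 0 -> nneg u && nneg v.

Lemma odd_regular_seq : exists g1 g2 f1 f2, regular_seq_type_S22_S4_S4 k.+2 c d g1 g2 f1 f2.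
Proof.
have [y1 _ _ _] := elem_sym_symmetric; have [i1 _ _ _] := elem_sym_homog.
have hE n : E1 ^+ n \is n.-homog by apply: (pow_homog i1); rewrite mul1n.
have eE (p : poly4) n v : (p ^+ n).@[v] = p.@[v] ^+ n by exact: rmorphXn.
have k0 : (0 < k)%N by rewrite kl.
have pow_eq0 (x : CC) m : x ^+ m = 0 -> x = 0.
  by move=> /eqP; rewrite expf_eq0 => /andP[_ /eqP].
have sA : A \is symmetric by case: AB => [] [[-> _] _] //; apply: symX.
have sB : B \is symmetric by case: AB => [] [[_ ->] _] //; apply: symX.
have hA : A \is k.-homog by case: AB => [] [[-> _] hM] //; apply: hE.
have hB : B = 0 \/ exists l, k = l.+2 /\ B \is l.-homog.
  by right; exists l; split; [exact: kl|case: AB => [] [[_ ->] hM] //; apply: hE].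
have pos u v : nneg u -> nneg v ->
    A.@[pt 1 1 u v] + B.@[pt 1 1 u v] * ((1 + u) * (1 + v)) != 0.
  move=> hu hv; have hm := M_ge0 hu hv.
  have hq : (1 + u) * (1 + v) = 1 + (u + v + u * v) by ring.
  have [p1 _] := nneg_pow_sum_neq0 l hu hv hm hq.
  have [_ p2] := nneg_pow_sum_neq0 k hu hv hm hq.
  by case: AB => [] [[-> ->] _]; rewrite eE eval_E1.
apply: (regular_seq_of_resolvent sA sB s1 s2 hA hB h1 h2) => //.
- move=> v vA vB; suff [e1 em] : E1.@[v] = 0 /\ M.@[v] = 0 by exact: Fgen e1 em.
  case: AB vA vB => [] [[-> ->] _]; rewrite eE; last by move=> /pow_eq0.
  by move=> em /pow_eq0.
- move=> u v u0 v0 e z1 z2.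
  have uv : v = - u.
    apply/eqP; rewrite -addr_eq0 addrC; apply/eqP.
    case: AB e => [] [[-> ->] _]; rewrite eE eval_E1 !M_00uv !add0r ?mul0r ?addr0; last exact: pow_eq0.
    by move=> /eqP; rewrite mulf_eq0 mulf_eq0 (negbTE u0) (negbTE v0) !orbF => /eqP /pow_eq0.
  by rewrite uv in z1 z2; exact: F00 u0 z1 z2.
- by move=> u v /eqP + z1 z2; have /andP[hu hv] := Fpos z1 z2; rewrite (negbTE (pos u v hu hv)).
- have := pos 0 0 (nneg_natr 0) (nneg_natr 0).
  by rewrite !addr0 !mulr1.
Qed.

End OddDegree.

(* The coefficients make [quadric] hyperbolic, with real nonnegative zeros on
   each of the lines [(1,1,u,0)], [(1,1,1/2,v)], [(1,1,2,v)], [(1,1,2v,v)]. *)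
Definition quadric : poly4 := 8%:R *: E1 ^+ 2 - 25%:R *: E2.

Lemma eval_quadric (v : 'I_4 -> CC) :
  quadric.@[v] = 8%:R * E1.@[v] ^+ 2 - 25%:R * E2.@[v].
Proof. by rewrite mevalB !mevalZ rmorphXn. Qed.

Lemma quadric_sym : quadric \is symmetric.
Proof.
have [y1 y2 _ _] := elem_sym_symmetric; apply/issymP => s.
by rewrite msymB !msymZ (issymP _ (symX 2 y1)) (issymP _ y2).
Qed.

Lemma quadric_homog : quadric \is 2.-homog.
Proof.
have [h1 h2 _ _] := elem_sym_homog.
by apply: rpredB; apply: dhomogZ => //; apply: (pow_homog h1).
Qed.

Lemma quadric_0001 : quadric.@[pt 0 0 0 1] = 8%:R.
Proof. by rewrite eval_quadric eval_E1 eval_E2; ring. Qed.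

Lemma quadric_00u (u : CC) : quadric.@[pt 0 0 u (- u)] = 25%:R * u ^+ 2.
Proof. by rewrite eval_quadric eval_E1 eval_E2; ring. Qed.

Lemma quadric_neq0 : quadric != 0.
Proof. by apply: (@poly4_neq0 _ (pt 0 0 0 1)); rewrite quadric_0001 natr_CC_neq0. Qed.

Lemma quadric_E2_eq0 (v : 'I_4 -> CC) : E1.@[v] = 0 -> quadric.@[v] = 0 -> E2.@[v] = 0.
Proof.
move=> e1; rewrite eval_quadric e1 expr0n mulr0 sub0r => /eqP.
by rewrite oppr_eq0 mulf_eq0 (negbTE (natr_CC_neq0 24)) => /eqP.
Qed.

(* The cubic is [(x+y-z)(x-y+z)(-x+y+z)] when the fourth coordinate is [0]; the
   weights [343] and [9] make all zeros of [sextic] on [(1,1,u,0)] rational and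
   nonnegative, see [sextic_11u0]. *)
Definition sextic : poly4 :=
  343%:R *: (E1 ^+ 3 - 4%:R *: (E1 * E2) + 8%:R *: E3) ^+ 2 + 9%:R *: (E1 ^+ 2 - 4%:R *: E2) ^+ 3.

Lemma eval_sextic (v : 'I_4 -> CC) : sextic.@[v] =
  343%:R * (E1.@[v] ^+ 3 - 4%:R * (E1.@[v] * E2.@[v]) + 8%:R * E3.@[v]) ^+ 2 +
  9%:R * (E1.@[v] ^+ 2 - 4%:R * E2.@[v]) ^+ 3.
Proof.
have eE (p : poly4) n : (p ^+ n).@[v] = p.@[v] ^+ n by exact: rmorphXn.
by rewrite mevalD !mevalZ !eE mevalD !mevalB !mevalZ !eE mevalM.
Qed.

Lemma sextic_sym : sextic \is symmetric.
Proof.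
have [y1 y2 y3 _] := elem_sym_symmetric; apply/issymP => s.
rewrite msymD !msymZ !rmorphXn /= msymD !msymB !msymZ !rmorphXn /= msymM.
by rewrite (issymP _ y1) (issymP _ y2) (issymP _ y3).
Qed.

Lemma sextic_homog : sextic \is 6.-homog.
Proof.
have [h1 h2 h3 _] := elem_sym_homog.
apply: rpredD; apply: dhomogZ.
  apply: (@pow_homog 3) => //; apply: rpredD; last exact: dhomogZ.
  apply: rpredB; first exact: (pow_homog h1).
  by apply: dhomogZ; exact: (dhomogM h1 h2).
apply: (@pow_homog 2) => //; apply: rpredB; first exact: (pow_homog h1).
exact: dhomogZ.
Qed.

Lemma sextic_0001 : sextic.@[pt 0 0 0 1] = 352%:R.
Proof. by rewrite eval_sextic eval_E1 eval_E2 eval_E3; ring. Qed.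

Lemma sextic_1110 : sextic.@[pt 1 1 1 0] = 100%:R.
Proof. by rewrite eval_sextic eval_E1 eval_E2 eval_E3; ring. Qed.

Lemma sextic_00u (u : CC) : sextic.@[pt 0 0 u (- u)] = 576%:R * u ^+ 6.
Proof. by rewrite eval_sextic eval_E1 eval_E2 eval_E3; ring. Qed.

Lemma sextic_11u0 (u : CC) : sextic.@[pt 1 1 u 0] =
  4%:R * u ^+ 3 * (2%:R * u - 1%:R) * (4%:R * u - 9%:R) * (11%:R * u - 16%:R).
Proof. by rewrite eval_sextic eval_E1 eval_E2 eval_E3; ring. Qed.

Lemma sextic_neq0 : sextic != 0.
Proof. by apply: (@poly4_neq0 _ (pt 0 0 0 1)); rewrite sextic_0001 natr_CC_neq0. Qed.

(** When neither 3 nor 4 divides the other degrees, this form must be nonzero at both [(1,w,w^2,0)]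
    and [(1,i,-1,-i)]; no coordinate there is twice another. Being a product of rational linear
    forms, it meets [(1,1,u,v)] in explicit lines; factors ['X_i - 'X_j] would vanish at all these
    points. *)
Definition double_coord_prod : poly4 :=
  \prod_i \prod_(j < 4 | j != i) ('X_i - 2%:R *: 'X_j).

Lemma double_coord_prod_sym : double_coord_prod \is symmetric.
Proof.
apply/issymP => s; rewrite rmorph_prod [RHS](reindex_inj (@perm_inj _ s)) /=.
apply: eq_bigr => i _; rewrite rmorph_prod [RHS](reindex_inj (@perm_inj _ s)) /=.
apply: eq_big => [j|j _]; first by rewrite (inj_eq (@perm_inj _ s)).
by rewrite msymB msymZ !msymXU.
Qed.

Lemma dhomog_prod_sum (n : nat) (R : comNzRingType) (I : finType) (P : pred I)
    (F : I -> {mpoly R[n]}) (d : I -> nat) :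
  (forall i, P i -> F i \is (d i).-homog) ->
  \prod_(i | P i) F i \is (\sum_(i | P i) d i).-homog.
Proof.
move=> h; elim/big_rec2: _ => [|i x y Pi IH]; first exact: dhomog1.
by apply: dhomogM => //; exact: h.
Qed.

Lemma double_coord_prod_homog : double_coord_prod \is 12.-homog.
Proof.
rewrite (_ : 12%N = \sum_(i < 4) \sum_(j < 4 | j != i) 1)%N.
  apply: dhomog_prod_sum => i _; apply: dhomog_prod_sum => j _.
  by apply: rpredB; [|apply: dhomogZ]; rewrite dhomogX /= mdeg1.
rewrite (eq_bigr (fun=> 3%N)); first by rewrite sum_nat_const card_ord.
by move=> i _; rewrite sum1_card cardC1 card_ord.
Qed.

Lemma double_coord_prod_eq0 (v : 'I_4 -> CC) : double_coord_prod.@[v] = 0 ->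
  exists i j, j != i /\ v i = 2%:R * v j.
Proof.
rewrite rmorph_prod /= => /eqP /prodf_eq0 [i _]; rewrite rmorph_prod /= => /prodf_eq0 [j ij].
rewrite mevalB mevalZ !mevalXU subr_eq0 => /eqP e.
by exists i, j.
Qed.

Lemma double_coord_prod_neq0 : double_coord_prod != 0.
Proof.
apply/prodf_neq0 => i _; apply/prodf_neq0 => j ij.
apply: (@poly4_neq0 _ (fun k => (k == i)%:R)).
by rewrite mevalB mevalZ !mevalXU eqxx (negbTE ij) mulr0 subr0 oner_neq0.
Qed.

Lemma neqCC (x y : CC) (n : nat) : x - y = n.+1%:R -> x <> y.
Proof. by move=> h e; move/eqP: h; rewrite e subrr eq_sym (negbTE (natr_CC_neq0 n)). Qed.

Lemma nneg_linear (a b : nat) (u : CC) : (0 < a)%N -> (0 < b)%N -> a%:R * u - b%:R = 0 -> nneg u.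
Proof.
move=> a0 b0 e; apply: (@nneg_quadratic (a ^ 2) (2 * a * b) (b ^ 2)); rewrite ?expn_gt0 ?muln_gt0 ?a0 //.
  by rewrite (_ : (2 * a * b) ^ 2 = 4 * a ^ 2 * b ^ 2)%N // !expnMn.
have -> : (a ^ 2)%:R * u ^+ 2 - (2 * a * b)%:R * u + (b ^ 2)%:R = (a%:R * u - b%:R) ^+ 2.
  by rewrite !natrX !natrM; ring.
by rewrite e expr0n.
Qed.

Lemma nneg_elem_sym (u v : CC) : nneg u -> nneg v ->
  [/\ nneg E2.@[pt 1 1 u v], nneg E3.@[pt 1 1 u v] & nneg E4.@[pt 1 1 u v]].
Proof.
move=> hu hv; have h1 : nneg 1 := nneg_natr 1.
rewrite eval_E2 eval_E3 eval_E4.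
by split; do ?[apply: nnegD|apply: nnegM].
Qed.

Section OddInstances.

Let sym2 : E2 \is symmetric. Proof. by case: elem_sym_symmetric. Qed.
Let sym3 : E3 \is symmetric. Proof. by case: elem_sym_symmetric. Qed.
Let sym4 : E4 \is symmetric. Proof. by case: elem_sym_symmetric. Qed.
Let hom2 : E2 \is 2.-homog. Proof. by case: elem_sym_homog. Qed.
Let hom3 : E3 \is 3.-homog. Proof. by case: elem_sym_homog. Qed.
Let hom4 : E4 \is 4.-homog. Proof. by case: elem_sym_homog. Qed.
Let E4_neq0 : E4 != 0. Proof. by case: elem_sym_neq0. Qed.

Let eval_pow (p : poly4) (m : nat) (v : 'I_4 -> CC) : (p ^+ m).@[v] = p.@[v] ^+ m.
Proof. exact: rmorphXn. Qed.

Let pow_eval0 (p : poly4) (m : nat) (v : 'I_4 -> CC) : (p ^+ m).@[v] = 0 -> p.@[v] = 0.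
Proof. by rewrite eval_pow => /eqP; rewrite expf_eq0 => /andP[_ /eqP]. Qed.

Let E4_11uv (u v : CC) : E4.@[pt 1 1 u v] = 0 -> (u == 0) || (v == 0).
Proof. by rewrite eval_E4 !mul1r => /eqP; rewrite mulf_eq0. Qed.

(** On [E1 = 0], [quadric] is a multiple of [E2], so [M], [f1], [f2] cut out [E3], [E4], [E2]. At
    [(1,1,u,v)], [E4 = 0] leaves [u = 0] or [v = 0], and the quadratic [8 u^2 - 18 u + 7]
    decides. *)
Lemma odd_instance_E4_quadric (k l c d r : nat) (A B : poly4) :
  k = l.+2 -> (0 < r)%N ->
  (A = E3 ^+ r /\ B = E1 ^+ l) /\ k = (3 * r)%N \/ (A = E1 ^+ k /\ B = E3 ^+ r) /\ l = (3 * r)%N ->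
  (4 %| c)%N -> ~~ odd d -> (0 < c)%N -> (0 < d)%N ->
  exists g1 g2 f1 f2, regular_seq_type_S22_S4_S4 k.+2 c d g1 g2 f1 f2.
Proof.
move=> kl r0 AB c4 dev c0 d0.
have quad_root u : quadric.@[pt 1 1 u 0] = 0 -> nneg u.
  move=> qu; apply: (@nneg_quadratic 8 18 7) => //.
  by rewrite -[RHS]qu eval_quadric eval_E1 eval_E2; ring.
apply: (@odd_regular_seq k l c d A B (E3 ^+ r) (E4 ^+ (c %/ 4)) (quadric ^+ d./2) kl).
- exact: symX.
- by case: AB => [] [eAB e]; [left|right]; split=> //; apply: pow_homog hom3 e.
- by move=> u v; rewrite eval_pow eval_E3 !(mul0r, addr0) expr0n gtn_eqF.
- by move=> u v hu hv; rewrite eval_pow; apply: nnegX; case: (nneg_elem_sym hu hv).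
- exact: symX.
- exact: symX quadric_sym.
- by apply: (pow_homog hom4); rewrite mulnC divnK.
- by apply: (pow_homog quadric_homog); rewrite mul2n even_halfK.
- exact: expf_neq0.
- exact: expf_neq0 quadric_neq0.
- move=> v e1 /pow_eval0 e3 /pow_eval0 e4 /pow_eval0 /(quadric_E2_eq0 e1) e2.
  exact: elem_sym_zero.
- by move=> _ /pow_eval0 /eqP; rewrite quadric_0001 (negbTE (natr_CC_neq0 7)).
- move=> t /pow_eval0; rewrite eval_E4 !mul1r => -> /pow_eval0 /eqP.
  rewrite eval_quadric eval_E1 eval_E2 (_ : _ - _ = - 3%:R); last by ring.
  by rewrite oppr_eq0 (negbTE (natr_CC_neq0 2)).
- move=> u u0 _ /pow_eval0 /eqP; rewrite quadric_00u mulf_eq0 expf_eq0 (negbTE u0).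
  by rewrite (negbTE (natr_CC_neq0 24)).
- move=> u v /pow_eval0 /E4_11uv /orP[] /eqP -> /pow_eval0.
    by rewrite (sym_swap23 _ _ _ _ quadric_sym) => /quad_root ->; rewrite (nneg_natr 0).
  by move/quad_root => ->; exact: (nneg_natr 0).
Qed.

(** Here no power of [E3] has degree [a - 2] or [a - 4], so [M] is a product of [E3] and a power of
    [E2]. On [E1 = 0], [sextic] is a combination of [E3^2] and [E2^3] with nonzero coefficients:
    once one of [E2], [E3] vanishes, so does the other. *)
Lemma odd_instance_E4_sextic (m c d : nat) : (4 %| c)%N -> (6 %| d)%N -> (0 < c)%N -> (0 < d)%N ->
  exists g1 g2 f1 f2, regular_seq_type_S22_S4_S4 (6 * m + 9) c d g1 g2 f1 f2.
Proof.
move=> c4 d6 c0 d0.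
have sextic_root u : sextic.@[pt 1 1 u 0] = 0 -> nneg u.
  rewrite sextic_11u0 => /eqP; rewrite 4!mulf_eq0 expf_eq0 (negbTE (natr_CC_neq0 3)) /=.
  case/orP=> [/orP[/orP[/eqP ->|/eqP]|/eqP]|/eqP].
  - exact: (nneg_natr 0).
  - exact: nneg_linear.
  - exact: nneg_linear.
  - exact: nneg_linear.
rewrite (_ : 6 * m + 9 = (6 * m + 7).+2)%N; last by lia.
apply: (@odd_regular_seq _ (6 * m + 5) c d (E1 ^+ (6 * m + 7)) (E3 * E2 ^+ (3 * m).+1)
  (E3 * E2 ^+ (3 * m).+1) (E4 ^+ (c %/ 4)) (sextic ^+ (d %/ 6))).
- by lia.
- exact: symM sym3 (symX _ sym2).
- right; split=> //; rewrite (_ : 6 * m + 5 = 3 + 2 * (3 * m).+1)%N; last by lia.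
  exact: dhomogM hom3 (dhomogMn _ hom2).
- by move=> u v; rewrite mevalM eval_E3 !(mul0r, addr0).
- move=> u v hu hv; rewrite mevalM eval_pow.
  by have [e2 e3 _] := nneg_elem_sym hu hv; apply: nnegM => //; apply: nnegX.
- exact: symX.
- exact: symX sextic_sym.
- by apply: (pow_homog hom4); rewrite mulnC divnK.
- by apply: (pow_homog sextic_homog); rewrite mulnC divnK.
- exact: expf_neq0.
- exact: expf_neq0 sextic_neq0.
- move=> v e1 em /pow_eval0 e4 /pow_eval0; rewrite eval_sextic e1 !expr0n /=.
  have := em; rewrite mevalM => /eqP; rewrite mulf_eq0 => /orP[/eqP e3|/eqP].
    rewrite e3 mul0r !mulr0 subr0 addr0 expr0n mulr0 add0r sub0r => /eqP.
    rewrite mulf_eq0 (negbTE (natr_CC_neq0 8)) expf_eq0 oppr_eq0 mulf_eq0.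
    by rewrite (negbTE (natr_CC_neq0 3)) /= => /eqP e2; exact: elem_sym_zero.
  move=> /pow_eval0 e2; rewrite e2 !mulr0 subr0 add0r expr0n mulr0 addr0 => /eqP.
  rewrite mulf_eq0 (negbTE (natr_CC_neq0 342)) expf_eq0 mulf_eq0.
  by rewrite (negbTE (natr_CC_neq0 7)) /= => /eqP e3; exact: elem_sym_zero.
- by move=> _ /pow_eval0 /eqP; rewrite sextic_0001 (negbTE (natr_CC_neq0 351)).
- move=> t /pow_eval0; rewrite eval_E4 !mul1r => -> /pow_eval0 /eqP.
  by rewrite sextic_1110 (negbTE (natr_CC_neq0 99)).
- move=> u u0 _ /pow_eval0 /eqP; rewrite sextic_00u mulf_eq0 expf_eq0 (negbTE u0).
  by rewrite (negbTE (natr_CC_neq0 575)).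
- move=> u v /pow_eval0 /E4_11uv /orP[] /eqP -> /pow_eval0.
    by rewrite (sym_swap23 _ _ _ _ sextic_sym) => /sextic_root ->; rewrite (nneg_natr 0).
  by move/sextic_root => ->; exact: (nneg_natr 0).
Qed.


Let forced_u (u v : CC) : 2%:R * u = 1 -> quadric.@[pt 1 1 u v] = 0 -> nneg u && nneg v.
Proof.
move=> hu; rewrite eval_quadric eval_E1 eval_E2 => q0; apply/andP; split.
  by apply: (@nneg_linear 2 1) => //; rewrite hu subrr.
have hu0 : 1 - 2%:R * u = 0 by rewrite hu subrr.
apply: (@nneg_quadratic 16 45 0) => //.
(* Twice the quadric at [u = 1/2] is [16 v^2 - 45 v]; the last term is the correction, a multiple of
   [1 - 2 u]. *)
have -> : 16%:R * v ^+ 2 - 45%:R * v + 0%:R =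
    2%:R * (8%:R * (1 + 1 + u + v) ^+ 2 - 25%:R * (1 * 1 + 1 * u + 1 * v + 1 * u + 1 * v + u * v)) +
    (1 - 2%:R * u) * (8%:R * u - 14%:R - 9%:R * v) by ring.
by rewrite q0 hu0 mulr0 mul0r addr0.
Qed.

Let forced_u2 (v : CC) : quadric.@[pt 1 1 2%:R v] = 0 -> nneg 2%:R && nneg v.
Proof.
rewrite eval_quadric eval_E1 eval_E2 => q0; rewrite nneg_natr /=.
by apply: (@nneg_quadratic 8 36 3) => //; rewrite -[RHS]q0; ring.
Qed.

Let forced_uv (v : CC) : quadric.@[pt 1 1 (2%:R * v) v] = 0 -> nneg (2%:R * v) && nneg v.
Proof.
rewrite eval_quadric eval_E1 eval_E2 => q0.
have hv : nneg v by apply: (@nneg_quadratic 22 54 7) => //; rewrite -[RHS]q0; ring.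
by rewrite hv nnegM // nneg_natr.
Qed.

Let double_quadric_nneg (u v : CC) :
  double_coord_prod.@[pt 1 1 u v] = 0 -> quadric.@[pt 1 1 u v] = 0 -> nneg u && nneg v.
Proof.
move=> /double_coord_prod_eq0 [i [j [ij e]]] q0.
have q0' : quadric.@[pt 1 1 v u] = 0 by rewrite (sym_swap23 _ _ _ _ quadric_sym).
have one_two : 1 <> 2%:R * 1 :> CC by apply/nesym/(@neqCC _ _ 0); ring.
move: i j ij e => [[|[|[|[|//]]]] lti] [[|[|[|[|//]]]] ltj] // _; rewrite /pt /= => e.
- exact: forced_u (esym e) q0.
- by rewrite andbC; exact: forced_u (esym e) q0'.
- exact: forced_u (esym e) q0.
- by rewrite andbC; exact: forced_u (esym e) q0'.
- by move: q0; rewrite e mulr1; exact: forced_u2.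
- by move: q0; rewrite e mulr1; exact: forced_u2.
- by move: q0; rewrite e; exact: forced_uv.
- by move: q0'; rewrite e mulr1 => /forced_u2; rewrite andbC.
- by move: q0'; rewrite e mulr1 => /forced_u2; rewrite andbC.
- by move: q0'; rewrite e => /forced_uv; rewrite andbC.
Qed.

Let double_quadric_111t (t : CC) :
  double_coord_prod.@[pt 1 1 1 t] = 0 -> quadric.@[pt 1 1 1 t] = 0 -> False.
Proof.
move=> /double_coord_prod_eq0 [i [j [ij e]]]; rewrite eval_quadric eval_E1 eval_E2 => q0.
have one_two : 1 <> 2%:R * 1 :> CC by apply/nesym/(@neqCC _ _ 0); ring.
have : 1 = 2%:R * t \/ t = 2%:R.
  move: i j ij e => [[|[|[|[|//]]]] lti] [[|[|[|[|//]]]] ltj] // _; rewrite /pt /= => e;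
  by [case: one_two | left | right; rewrite e mulr1].
case=> ht; last first.
  have /eqP := natr_CC_neq0 24; apply.
  by rewrite -[RHS]oppr0 -q0 ht; ring.
have /eqP := natr_CC_neq0 57; apply.
have hu0 : 1 - 2%:R * t = 0 by rewrite -ht subrr.
(* At [t = 1/2] the quadric takes the value [-58/4]. *)
have -> : 58%:R = (1 - 2%:R * t) * (46%:R - 16%:R * t) - 4%:R *
    (8%:R * (1 + 1 + 1 + t) ^+ 2 - 25%:R * (1 * 1 + 1 * 1 + 1 * t + 1 * 1 + 1 * t + 1 * t)).
  by ring.
by rewrite q0 hu0 mul0r mulr0 subr0.
Qed.

(** With [E1 = E2 = 0], every coordinate satisfies [x^4 = E3 x - E4]. For [v i = 2 v j] this gives
    [14 E3 v_j = 15 E4]. So [E3 = 0] implies [E4 = 0]; conversely [E4 = 0] gives [E3 = 0] or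
    [v j = v i = 0], and two zero coordinates also make [E3] vanish. *)
Let double_generic (v : 'I_4 -> CC) (r : nat) : E1.@[v] = 0 -> E2.@[v] = 0 ->
  (E3 ^+ r * E4).@[v] = 0 -> double_coord_prod.@[v] = 0 -> forall i, v i = 0.
Proof.
move=> e1 e2 em /double_coord_prod_eq0 [i [j [ij e]]].
have vi := vieta4 v i; have vj := vieta4 v j.
rewrite e1 e2 !mul0r subrr add0r in vi; rewrite e1 e2 !mul0r subrr add0r in vj.
rewrite e in vi.
have key : 14%:R * (E3.@[v] * v j) = 15%:R * E4.@[v].
  have h : E3.@[v] * (2%:R * v j) - E4.@[v] = 16%:R * (E3.@[v] * v j - E4.@[v]).
    by rewrite -vi -vj; ring.
  have -> : 14%:R * (E3.@[v] * v j) = 15%:R * E4.@[v] +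
      (16%:R * (E3.@[v] * v j - E4.@[v]) - (E3.@[v] * (2%:R * v j) - E4.@[v])) by ring.
  by rewrite h subrr addr0.
have e34 : E3.@[v] = 0 -> E4.@[v] = 0.
  move=> e3; move: key; rewrite e3 mul0r mulr0 => /esym/eqP.
  by rewrite mulf_eq0 (negbTE (natr_CC_neq0 14)) => /eqP.
move: em; rewrite mevalM => /eqP; rewrite mulf_eq0 => /orP[/eqP /pow_eval0 e3|/eqP e4].
  by apply: elem_sym_zero => //; exact: e34.
apply: elem_sym_zero => //; apply/eqP.
move/eqP: key; rewrite e4 mulr0 !mulf_eq0 (negbTE (natr_CC_neq0 13)) /= => /orP[//|/eqP vj0].
have vi0 : v i = 0 by rewrite e vj0 mulr0.
move: ij vi0 vj0; rewrite (pt_val v i) (pt_val v j) (eval_pt E3) eval_E3.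
move: (v (inord 0)) (v (inord 1)) (v (inord 2)) (v (inord 3)) => x y z w.
move: i j {e vi vj} => [[|[|[|[|//]]]] lti] [[|[|[|[|//]]]] ltj] // _; rewrite /pt /= => -> ->;
  by rewrite !(mul0r, mulr0, addr0).
Qed.

Lemma odd_instance_double_quadric (m c d : nat) :
  (12 %| c)%N -> ~~ odd d -> (0 < c)%N -> (0 < d)%N ->
  exists g1 g2 f1 f2, regular_seq_type_S22_S4_S4 (6 * m + 9) c d g1 g2 f1 f2.
Proof.
move=> c12 dev c0 d0.
rewrite (_ : 6 * m + 9 = (6 * m + 7).+2)%N; last by lia.
apply: (@odd_regular_seq _ (6 * m + 5) c d (E3 ^+ (2 * m).+1 * E4) (E1 ^+ (6 * m + 5))
  (E3 ^+ (2 * m).+1 * E4) (double_coord_prod ^+ (c %/ 12)) (quadric ^+ d./2)).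
- by lia.
- exact: symM (symX _ sym3) sym4.
- left; split=> //; rewrite (_ : 6 * m + 7 = 3 * (2 * m).+1 + 4)%N; last by lia.
  exact: dhomogM (dhomogMn _ hom3) hom4.
- by move=> u v; rewrite mevalM eval_E4 !(mul0r, mulr0).
- move=> u v hu hv; rewrite mevalM eval_pow.
  by have [_ e3 e4] := nneg_elem_sym hu hv; apply: nnegM => //; apply: nnegX.
- exact: symX double_coord_prod_sym.
- exact: symX quadric_sym.
- by apply: (pow_homog double_coord_prod_homog); rewrite mulnC divnK.
- by apply: (pow_homog quadric_homog); rewrite mul2n even_halfK.
- exact: expf_neq0 double_coord_prod_neq0.
- exact: expf_neq0 quadric_neq0.
- move=> v e1 em /pow_eval0 z1 /pow_eval0 /(quadric_E2_eq0 e1) e2.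
  exact: double_generic e1 e2 em z1.
- by move=> _ /pow_eval0 /eqP; rewrite quadric_0001 (negbTE (natr_CC_neq0 7)).
- by move=> t /pow_eval0 z1 /pow_eval0; exact: double_quadric_111t.
- move=> u u0 _ /pow_eval0 /eqP; rewrite quadric_00u mulf_eq0 expf_eq0 (negbTE u0).
  by rewrite (negbTE (natr_CC_neq0 24)).
- by move=> u v /pow_eval0 z1 /pow_eval0; exact: double_quadric_nneg.
Qed.

End OddInstances.

Lemma odd_degree_exists (a c d : nat) : (5 <= a)%N -> odd a -> (0 < c)%N -> (0 < d)%N ->
  ~~ odd c -> ~~ odd d -> (4 %| c)%N || (4 %| d)%N ->
  [|| 3 %| a - 2, 3 %| a - 4, 3 %| c | 3 %| d]%N ->
  exists g1 g2 f1 f2, regular_seq_type_S22_S4_S4 a c d g1 g2 f1 f2.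
Proof.
move=> a5 ao; wlog c4 : c d / (4 %| c)%N.
  move=> wl c0 d0 ce de /orP[c4|d4] h3; first by apply: wl; rewrite ?c4.
  have [||||||g1 [g2 [f1 [f2 [[h1 h2 h3' h4] [S [s1 [s2 z]]]]]]]] // := wl d c d4.
  - by rewrite d4.
  - by move: h3; rewrite [((3 %| c) || _)%N]orbC.
  exists g1, g2, f2, f1; split=> //; split=> //; split=> //; split=> // v v1 v2 v3 v4.
  exact: z v1 v2 v4 v3.
move=> c0 d0 ce de _ h3.
have [k ak] : exists k, a = k.+4.+1 by exists (a - 5)%N; lia.
have [/dvdnP [r kr]|n2] := boolP (3 %| a - 2)%N.
  rewrite ak; apply: (@odd_instance_E4_quadric k.+3 k.+1 c d r (E3 ^+ r) (E1 ^+ k.+1)) => //.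
    by lia.
  by left; split=> //; lia.
have [/dvdnP [r kr]|n4] := boolP (3 %| a - 4)%N.
  rewrite ak; apply: (@odd_instance_E4_quadric k.+3 k.+1 c d r (E1 ^+ k.+3) (E3 ^+ r)) => //.
    by lia.
  by right; split=> //; lia.
(* Only odd multiples of 3 remain, and [a >= 5] makes 9 the smallest. *)
have [m am] : exists m, a = (6 * m + 9)%N by exists ((a - 9) %/ 6)%N; move: a5 ao n2 n4; clear; lia.
rewrite am; have [c3|nc3] := boolP (3 %| c)%N.
  by apply: odd_instance_double_quadric => //; rewrite (@Gauss_dvd 3 4) // c3.
apply: odd_instance_E4_sextic => //.
move: h3; rewrite (negbTE n2) (negbTE n4) (negbTE nc3) /= => d3.
by rewrite (@Gauss_dvd 2 3) // dvdn2 de.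
Qed.

Local Close Scope ring_scope.

Theorem theorem4p5 (a c d : nat) :
  (0 < a)%N -> (0 < c)%N -> (0 < d)%N ->
  ((exists g1 g2 f1 f2 : poly4, regular_seq_type_S22_S4_S4 a c d g1 g2 f1 f2) <->
   (((a = 2 \/ a = 4) /\ (c, d) <> (1, 1)%N) \/
    ((5 <= a)%N /\ regular_degree_sequence (a - 2) (a - 4) c d))).
Proof.
move=> a0 c0 d0; split.
  by move=> [g1 [g2 [f1 [f2 h]]]]; exact: regular_seq_degrees h.
case=> [[a24 cd]|[a5 reg]].
  by apply: even_degree_exists => //; case: a24 => ->.
have a2 : (0 < a - 2)%N by rewrite subn_gt0 (leq_trans _ a5).
have a4 : (0 < a - 4)%N by rewrite subn_gt0.
have h3 := regular_degree_dvd3 reg; have h4 := regular_degree_dvd4 reg.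
have [ao|ae] := boolP (odd a).
  have o2 : odd (a - 2) by rewrite oddB ?ao // (leq_trans _ a5).
  have o4 : odd (a - 4) by rewrite oddB ?ao // (leq_trans _ a5).
  have [ce de] := regular_degree_even c0 d0 reg o2 o4.
  apply: odd_degree_exists => //.
  have odd4 x : odd x -> (4 %| x)%N = false.
    by move=> ox; apply/negP => /(dvdn_trans (isT : 2 %| 4)%N); rewrite dvdn2 ox.
  by move: h4; rewrite (odd4 _ o2) (odd4 _ o4).
apply: even_degree_exists => //; first by rewrite (leq_trans _ a5).
  exact: regular_degree_not11 a2 a4 reg.
by rewrite h3 orbT.
Qed.
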